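(* Assume that the Boshernitzan--Kornfeld Conjecture holds, i.e. that for all $r\ge 2$ the set of all infinite type maps is a (Lebesgue) measure zero subset of $\mathrm{ITM}(r)$. Then for all $r\ge 2$ the set of all maps in $\mathrm{ITM}(r)$ that correspond to an irrational rotation forms a full measure subset of $\mathrm{ITM}(r)$.
   Context: Let $I=[0,1)$ and $r\ge 2$. The parameter space $\mathrm{ITM}(r)\subset\mathbb{R}^{2r-1}$ is the set of vectors $(\gamma_1,\dots,\gamma_r,\beta_1,\dots,\beta_{r-1})$ with $0=\beta_0<\beta_1<\dots<\beta_{r-1}<\beta_r=1$ and $\gamma_i\in[-\beta_{i-1},1-\beta_i]$ for $1\le i\le r$, with the Lebesgue measure induced from $\mathbb{R}^{2r-1}$. Each such vector is identified with the interval translation map $T\colon I\to I$, $T(x)=x+\gamma_i$ for $x\in[\beta_{i-1},\beta_i)$. For $T\in\mathrm{ITM}(r)$ put $X_n=T^n(I)$ and $X=\bigcap_{n\ge 0}X_n$. $T$ is of finite type if $X_{n+1}=X_n$ for some $n$, and of infinite type otherwise. If $T$ is of finite type, $X$ is a finite union of half-open intervals; an interval component of $X$ is a connected component $J=[x,y)$ of $X$. The first return map $R_J\colon J\to J$ is $R_J(z)=T^{k}(z)$ with $k=k(z)\ge 1$ minimal such that $T^k(z)\in J$ (it is defined on all of $J$ and bijective). $T$ corresponds to an irrational rotation if it is of finite type and, for every interval component $J$ of $X$, the return map $R_J$ is isomorphic to an irrational circle rotation, i.e. under the identification of $J=[x,y)$ with the circle $\mathbb{R}/(y-x)\mathbb{Z}$,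 $R_J$ is the rotation by an irrational multiple of $y-x$. *)

(* Defs.v *)
From HB Require Import structures.
From mathcomp Require Import all_boot all_order all_algebra.
From mathcomp Require Import all_classical all_reals all_analysis.

Set Implicit Arguments.
Unset Strict Implicit.
Unset Printing Implicit Defensive.

Import Order.TTheory GRing.Theory Num.Theory.
Import numFieldNormedType.Exports.

Local Open Scope classical_set_scope.
Local Open Scope ring_scope.

(* R^n, with the Borel sigma-algebra that the library puts on n-tuples. *)
Notation euclid R n := (n.-tuple (measurableTypeR R)).

Section lebesgue_tuple.
Context (R : realType).
Local Open Scope ereal_scope.

Definition tuple_of_pair n (p : measurableTypeR R * euclid R n) :
  euclid R n.+1 := [the n.+1.-tuple _ of p.1 :: p.2].

(* The n-dimensional Lebesgue measure on Borel sets, as the iterated product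
   of the one-dimensional one; lebesgue_tuple_box is its value on boxes. The
   null sets of the completed Lebesgue measure are its negligible sets. *)
Fixpoint lebesgue_tuple (n : nat) : set (euclid R n) -> \bar R :=
  match n with
  | 0 => \d_ ([tuple] : euclid R 0)
  | n'.+1 => pushforward
      ((@lebesgue_measure R \x lebesgue_tuple (n := n'))%E) (@tuple_of_pair n')
  end.

Lemma measurable_tuple_of_pair n : measurable_fun setT (@tuple_of_pair n).
Proof. exact: measurable_cons. Qed.

Let pair_of_tuple n (t : euclid R n.+1) : measurableTypeR R * euclid R n :=
  (thead t, [tuple of behead t]).

Let measurable_pair_of_tuple n : measurable_fun setT (@pair_of_tuple n).
Proof.
have mh : measurable_fun setT (fun t : euclid R n.+1 => thead t).
  exact: measurable_tnth.
exact: measurable_fun_pair mh (@measurable_behead _ _ n).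
Qed.

Let tuple_of_pairK n : cancel (@tuple_of_pair n) (@pair_of_tuple n).
Proof.
move=> [x t]; rewrite [LHS](_ : _ = (x, [tuple of behead (x :: t)]))//.
by congr pair; exact/val_inj.
Qed.

Section lebesgue_tupleS.
Context (n : nat) (mu : {sigma_finite_measure set (euclid R n) -> \bar R}).

Definition lebesgue_tupleS : set (euclid R n.+1) -> \bar R :=
  pushforward (@lebesgue_measure R \x mu) (@tuple_of_pair n).

Let m0 : lebesgue_tupleS set0 = 0.
Proof. by rewrite /lebesgue_tupleS /pushforward preimage_set0 measure0. Qed.

Let m_ge0 A : 0 <= lebesgue_tupleS A.
Proof. by rewrite /lebesgue_tupleS /pushforward. Qed.

Let m_sigma_additive : semi_sigma_additive lebesgue_tupleS.
Proof.
move=> F mF tF mUF.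
have mT A : measurable A -> measurable (@tuple_of_pair n @^-1` A).
  by move=> mA; rewrite -[X in measurable X]setTI; exact: measurable_tuple_of_pair.
rewrite /lebesgue_tupleS /pushforward preimage_bigcup.
apply: measure_semi_sigma_additive => [k||]; first exact: mT.
  apply/trivIsetP => /= i j _ _ ij; rewrite -preimage_setI.
  by move/trivIsetP : tF => /(_ _ _ _ _ ij) ->//; rewrite preimage_set0.
by rewrite -preimage_bigcup; exact: mT.
Qed.

HB.instance Definition _ := isMeasure.Build _ _ _ lebesgue_tupleS
  m0 m_ge0 m_sigma_additive.

Let m_sigma_finite : sigma_finite setT lebesgue_tupleS.
Proof.
have /sigma_finiteP[F [TF ndF Foo]] := sigma_finiteT (@lebesgue_measure R).
have /sigma_finiteP[G [TG ndG Goo]] := sigma_finiteT mu.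
exists (fun k => @pair_of_tuple n @^-1` (F k `*` G k)).
  rewrite predeqE => t; split => // _.
  have [k _ Fkt] : (\bigcup_k F k) (pair_of_tuple t).1 by rewrite -TF.
  have [l _ Glt] : (\bigcup_k G k) (pair_of_tuple t).2 by rewrite -TG.
  exists (maxn k l) => //; split.
  - by move: Fkt; exact/subsetPset/ndF/leq_maxl.
  - by move: Glt; exact/subsetPset/ndG/leq_maxr.
move=> k; have [mFk Fkoo] := Foo k; have [mGk Gkoo] := Goo k; split.
  rewrite -[X in measurable X]setTI; apply: measurable_pair_of_tuple => //.
  exact: measurableX.
rewrite /lebesgue_tupleS /pushforward.
rewrite (_ : _ @^-1` _ = F k `*` G k); last first.
  apply/funext => p.
  by rewrite -[in RHS](tuple_of_pairK p).
by rewrite product_measure1E// lte_mul_pinfty// ge0_fin_numE.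
Qed.

HB.instance Definition _ := @Measure_isSigmaFinite.Build _ _ _ lebesgue_tupleS
  m_sigma_finite.

End lebesgue_tupleS.

Let lebesgue_tuple_ex n : exists mu :
  {sigma_finite_measure set (euclid R n) -> \bar R}, @lebesgue_tuple n = mu.
Proof.
elim: n => [|n [mu mun]].
  by exists (\d_ ([tuple] : euclid R 0) : {sigma_finite_measure set _ -> \bar R}).
by exists (@lebesgue_tupleS n mu); rewrite /= mun.
Qed.

Section lebesgue_tuple_measure.
Context (n : nat).

Let m0 : @lebesgue_tuple n set0 = 0.
Proof. by have [mu ->] := lebesgue_tuple_ex n; exact: measure0. Qed.

Let m_ge0 A : 0 <= @lebesgue_tuple n A.
Proof. by have [mu ->] := lebesgue_tuple_ex n; exact: measure_ge0. Qed.

Let m_sigma_additive : semi_sigma_additive (@lebesgue_tuple n).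
Proof.
by have [mu ->] := lebesgue_tuple_ex n; exact: measure_semi_sigma_additive.
Qed.

HB.instance Definition _ := isMeasure.Build _ _ _ (@lebesgue_tuple n)
  m0 m_ge0 m_sigma_additive.

Let m_sigma_finite : sigma_finite setT (@lebesgue_tuple n).
Proof. by have [mu ->] := lebesgue_tuple_ex n; exact: sigma_finiteT. Qed.

HB.instance Definition _ := @Measure_isSigmaFinite.Build _ _ _
  (@lebesgue_tuple n) m_sigma_finite.

End lebesgue_tuple_measure.

Lemma lebesgue_tuple_box n (A : 'I_n -> set (measurableTypeR R)) :
  (forall i, measurable (A i)) ->
  lebesgue_tuple [set t : euclid R n | forall i, A i (tnth t i)] =
  \prod_(i < n) lebesgue_measure (A i).
Proof.
elim: n A => [|n ih] A mA.
  rewrite big_ord0 /= diracE mem_set//= => -[]//.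
rewrite big_ord_recl -ih//=.
set B := (X in _ = _ * lebesgue_tuple X).
have mB : measurable B.
  rewrite (_ : B = \bigcap_(i in [set: 'I_n])
      ((fun t : euclid R n => tnth t i) @^-1` A (lift ord0 i))).
    apply: fin_bigcap_measurable => // i _.
    by rewrite -[X in measurable X]setTI; exact: measurable_tnth.
  by apply/seteqP; split=> t /= Bt i => [_|]; exact: Bt.
rewrite -product_measure1E//= /pushforward; congr (_ _).
apply/seteqP; split=> -[x t]/=.
  move=> Axt; split; first exact: (Axt ord0).
  by move=> i; have := Axt (lift ord0 i); rewrite tnthS.
move=> [Ax Bt] i; have [->//|[j ->]] : i = ord0 \/ exists j, i = lift ord0 j.
  by case: (unliftP ord0 i) => [j|] ->; [right; exists j|left].
by rewrite tnthS; exact: Bt.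
Qed.

End lebesgue_tuple.

Section interval_translation_maps.
Context (R : realType) (r : nat).
Implicit Types (v : euclid R (2 * r - 1)%N) (x y z : R) (J : set R) (f : R -> R).

(* A vector v lists (gamma_1, ..., gamma_r, beta_1, ..., beta_(r-1)). *)
Definition gamma v (i : nat) : R := nth (0 : R) v i.-1.

Definition beta v (j : nat) : R :=
  if j == 0%N then 0 else if j == r then 1 else nth (0 : R) v (r + j.-1)%N.

Definition ITM : set (euclid R (2 * r - 1)%N) :=
  [set v | (forall j, (j < r)%N -> beta v j < beta v j.+1) /\
           (forall i, (1 <= i <= r)%N ->
              - beta v i.-1 <= gamma v i <= 1 - beta v i)].

(* At most one i contributes to the sum; outside [0, 1) this total function is
   the identity, but it is only ever iterated from points of [0, 1). *)
Definition itm v x : R :=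
  x + \sum_(1 <= i < r.+1 | beta v i.-1 <= x < beta v i) gamma v i.

Definition itm_image v (n : nat) : set R := iter n (itm v) @` `[0, 1[.

Definition attractor v : set R := \bigcap_n itm_image v n.

Definition finite_type : set (euclid R (2 * r - 1)%N) :=
  [set v | exists n, itm_image v n.+1 = itm_image v n].

Definition infinite_type : set (euclid R (2 * r - 1)%N) := ~` finite_type.

Definition interval_component v x y : Prop :=
  exists2 z, attractor v z &
    connected_component (attractor v) z = `[x, y[%classic.

Definition is_return_time f J z (k : nat) : Prop :=
  [/\ (0 < k)%N, J (iter k f z) &
      forall j, (0 < j < k)%N -> ~ J (iter j f z)].

(* If z never returns to J, the time is 0 by convention. *)
Definition first_return_time f J z : nat := xget 0%N (is_return_time f J z).

Definition first_return_map f J z : R := iter (first_return_time f J z) f z.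

(* On [x, y), identified with R / (y - x)Z, the map g is the rotation by
   a * (y - x) for some irrational a. *)
Definition irrational_rotation x y (g : R -> R) : Prop :=
  exists2 a, irrational a & forall z, x <= z < y ->
    x <= g z < y /\
    exists m : int, g z = z + a * (y - x) + m%:~R * (y - x).

Definition irrational_rotation_type : set (euclid R (2 * r - 1)%N) :=
  [set v | finite_type v /\
     forall x y, interval_component v x y ->
       irrational_rotation x y (first_return_map (itm v) `[x, y[%classic)].

End interval_translation_maps.

Arguments ITM : clear implicits.
Arguments infinite_type : clear implicits.
Arguments irrational_rotation_type : clear implicits.

(* No measurability is claimed: a set is null when it is contained in a Borel
   set of measure 0. *)
Definition Boshernitzan_Kornfeld (R : realType) : Prop :=
  forall r : nat, (2 <= r)%N ->
    (@lebesgue_tuple R (2 * r - 1)%N).-negligible (ITM R r `&` infinite_type R r).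

(* Main.v *)
(* Outside a null set the parameters of a map are linearly independent over the
   integers, so that no point is periodic, and an orbit of one discontinuity
   meets an orbit of another, or of itself, only with the same numbers of visits
   to each branch. Let [X] be the attractor of such a map of finite type. The map
   is a bijection of [X], and so every left endpoint of [X] lies on the right
   orbit of a discontinuity [b] inside [X], and every right endpoint on the left
   orbit of one. The right and the left orbit of [b] run along endpoints of [X]
   until they meet again, after the same number of steps and the same visits to
   each branch. Hence the number of points [<= z] of the first orbit segment minus
   that of the second is, as a function of [z], invariant under the transfer
   operator, and its support lies in [X]; this forces the two endpoints of each
   component [J] of [X] to come from one and the same discontinuity. Comparing
   the return times to [J] from the two sides of a point, the two orbits
   either return together, or one to the left end of [J] and the other to the
   right end. So the displacement of the return map is locally constant modulo
   the length of [J], which makes this map a rotation, by an irrational angle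
   since there is no periodic point. *)

Require Import Defs.
From mathcomp Require Import all_boot all_order all_algebra.
From mathcomp Require Import all_classical all_reals all_analysis.
From mathcomp Require Import measurable_realfun zify ring lra.

Set Implicit Arguments.
Unset Strict Implicit.
Unset Printing Implicit Defensive.

Import Order.TTheory GRing.Theory Num.Theory.
Import numFieldNormedType.Exports.

Local Open Scope classical_set_scope.
Local Open Scope ring_scope.

(** * Counting and pigeonhole on finite sequences *)

Section sequences.

(** A predicate closed under predecessor holds on an initial segment of [[1, n]], whose length is
    the count. *)
Lemma count_iota_down (p : pred nat) n j :
  (forall i, (0 < i < n)%N -> p i.+1 -> p i) -> (0 < j <= n)%N ->
  (j <= count p (iota 1 n))%N = p j.
Proof.
move=> dp /andP[j0 jn].
have down i k : (0 < i)%N -> (i + k <= n)%N -> p (i + k)%N -> p i.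
  elim: k => [|k ih] i0 ikn; first by rewrite addn0.
  rewrite addnS => pk; apply: ih => //; first by lia.
  by apply: dp => //; lia.
have [pj|npj] := boolP (p j).
  have /eqP cj : count p (iota 1 j) == size (iota 1 j).
    rewrite -all_count; apply/allP => i; rewrite mem_iota => ij.
    by apply: (@down i (j - i)%N); rewrite ?subnKC//; lia.
  by rewrite -(subnKC jn) iotaD count_cat cj size_iota leq_addr.
apply/negbTE; rewrite -ltnNge.
have -> : n = (j.-1 + (n - j.-1))%N by lia.
rewrite iotaD count_cat; set c := count p (iota (1 + j.-1) _).
have -> : c = 0%N.
  apply/eqP; rewrite -leqn0 leqNgt -has_count; apply/negP => /hasP[i].
  rewrite mem_iota => /andP[ji iN] pi; move/negP: npj; apply.
  apply: (@down j (i - j)%N) => //; first by lia.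
  by rewrite subnKC//; lia.
have := count_size p (iota 1 j.-1); rewrite size_iota.
by lia.
Qed.

Lemma mem_iota1 n j : (0 < j < n)%N -> j \in iota 1 n.-1.
Proof. by rewrite mem_iota; lia. Qed.

Lemma pigeonhole_seq (T : eqType) (E : seq T) (f : nat -> T) :
  (forall n, (n <= size E)%N -> f n \in E) ->
  exists i j, (i < j <= size E)%N /\ f i = f j.
Proof.
move=> fE; have [u|] := boolP (uniq (map f (iota 0 (size E).+1))).
  have := @uniq_leq_size _ _ E u; rewrite size_map size_iota ltnn => H.
  suff /H : {subset map f (iota 0 (size E).+1) <= E} by [].
  by move=> x /mapP[n]; rewrite mem_iota => nE ->; exact: fE.
move/(uniqPn (f 0%N)) => [i [j [ij]]]; rewrite size_map size_iota => jE.
have iE : (i < (size E).+1)%N by lia.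
rewrite !(nth_map 0%N) ?size_iota ?nth_iota// !add0n.
by move=> fij; exists i, j; split=> //; lia.
Qed.

End sequences.

(** * One-sided germs and finite unions of half-open intervals *)

Section germs.
Context {R : realType}.
Implicit Types (s : bool) (a z w : R) (P Q : set R).

(* [true] is the right side, which includes the point itself, and [false] the
   left side: half-open intervals [a, b[ are unions of such germs. *)
Definition germ s z P : Prop :=
  exists2 e, 0 < e & forall w, (if s then z <= w < z + e else z - e < w < z) ->
    P w.

(** This is the eventual truth value of [a <= w] as [w] tends to [z] from side [s]. *)
Definition leg s a z := if s then a <= z else a < z.

Lemma germS s z P Q : P `<=` Q -> germ s z P -> germ s z Q.
Proof. by move=> PQ [e e0 eP]; exists e => // w /eP /PQ. Qed.

Lemma germI s z P Q : germ s z P -> germ s z Q -> germ s z (P `&` Q).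
Proof.
case: s => -[e e0 eP] [f f0 fQ]; exists (Num.min e f); rewrite ?lt_min ?e0//;
  move=> w /andP[h1 h2]; split; [apply: eP|apply: fQ|apply: eP|apply: fQ];
  apply/andP; split => //.
- by rewrite (lt_le_trans h2)// lerD2l ge_min lexx.
- by rewrite (lt_le_trans h2)// lerD2l ge_min lexx orbT.
- by rewrite (le_lt_trans _ h1)// lerD2l lerN2 ge_min lexx.
- by rewrite (le_lt_trans _ h1)// lerD2l lerN2 ge_min lexx orbT.
Qed.

Lemma germT s z : germ s z setT.
Proof. by exists 1. Qed.

Lemma germ_ex s z P : germ s z P -> exists w, P w.
Proof.
move=> [e e0 eP]; case: s eP => eP.
  by exists z; apply: eP; rewrite lexx ltrDl.
by exists (z - e / 2); apply: eP; lra.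
Qed.

Lemma germ_at z P : germ true z P -> P z.
Proof. by move=> [e e0 eP]; apply: eP; rewrite lexx ltrDl. Qed.

Lemma germ_shift s z c P : germ s z P -> germ s (z + c) (fun w => P (w - c)).
Proof.
move=> [e e0 eP]; exists e => // w zw; apply: eP.
by case: s zw => ?; lra.
Qed.

Lemma germ_all (I : eqType) (r : seq I) s z (P : I -> set R) :
  (forall i, i \in r -> germ s z (P i)) ->
  germ s z (fun w => forall i, i \in r -> P i w).
Proof.
elim: r => [|i r ih] H; first by apply: germS (germT s z).
have Hi := H i (mem_head _ _).
have {}ih : germ s z (fun w => forall i, i \in r -> P i w).
  by apply: ih => j jr; apply: H; rewrite in_cons jr orbT.
apply: germS (germI Hi ih) => w [Pi Pr] j; rewrite in_cons => /orP[/eqP->//|].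
exact: Pr.
Qed.

Lemma germ_leg s a z : germ s z (fun w => (a <= w) = leg s a z).
Proof.
case: s => /=.
  have [az|za] := leP a z.
    by exists 1 => // w /andP[zw _]; rewrite (le_trans az).
  exists (a - z) => [|w]; first by rewrite subr_gt0.
  by move=> /andP[zw wa]; apply/negbTE; rewrite -ltNge; lra.
have [az|za] := ltP a z.
  exists (z - a) => [|w]; first by rewrite subr_gt0.
  by move=> /andP[zw wa]; lra.
by exists 1 => // w /andP[_ wz]; apply/negbTE; rewrite -ltNge; lra.
Qed.

(** Finite unions of half-open intervals, rays allowed, are encoded by thresholds; in this form
    intersections, shifts and finite unions are immediate. *)
Definition step_set P : Prop := exists E : seq R, forall z w, z <= w ->
  (forall e, e \in E -> (e <= z) = (e <= w)) -> P z <-> P w.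

(** Close enough to [z] on one side, all thresholds compare with the point in one fixed way. *)
Lemma step_germ s z P : step_set P -> germ s z P \/ germ s z (~` P).
Proof.
move=> [E EP].
have H : germ s z (fun w => forall e, e \in E -> (e <= w) = leg s e z).
  by apply: germ_all => e _; exact: germ_leg.
have [w0 Ew0] := germ_ex H.
have K : germ s z (fun w => P w0 <-> P w).
  apply: germS H => w Ew; have [le|/ltW le] := leP w0 w.
    by apply: EP => // e eE; rewrite Ew0// Ew.
  by apply: iff_sym; apply: EP => // e eE; rewrite Ew0// Ew.
have [P0|P0] := pselect (P w0); [left|right]; apply: germS K => w; rewrite /setC/=; tauto.
Qed.

Lemma step_at z P : step_set P -> P z <-> germ true z P.
Proof.
move=> sP; split=> [Pz|/germ_at//].
by have [//|/germ_at] := step_germ true z sP.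
Qed.

Lemma step_setI P Q : step_set P -> step_set Q -> step_set (P `&` Q).
Proof.
move=> [E EP] [F FQ]; exists (E ++ F) => z w zw H.
have A : P z <-> P w by apply: EP => // e eE; apply: H; rewrite mem_cat eE.
have B : Q z <-> Q w.
  by apply: FQ => // e eE; apply: H; rewrite mem_cat eE orbT.
by rewrite /setI/= A B.
Qed.

Lemma step_set_shift c P : step_set P -> step_set (fun w => P (w - c)).
Proof.
move=> [E EP]; exists (map (fun e => e + c) E) => z w zw H.
apply: EP => [|e eE]; first by rewrite lerD2r.
by rewrite !lerBrDr; apply: H; apply/mapP; exists e.
Qed.

Lemma step_set_ex (I : eqType) (r : seq I) (P : I -> set R) :
  (forall i, i \in r -> step_set (P i)) ->
  step_set (fun w => exists2 i, i \in r & P i w).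
Proof.
elim: r => [|i r ih] H; first by exists [::] => z w _ _; split=> -[].
have [E EP] := H i (mem_head _ _).
have [F FP] := ih (fun j jr => H j (mem_behead (s := i :: r) jr)).
exists (E ++ F) => z w zw K.
have A : P i z <-> P i w by apply: EP => // e eE; apply: K; rewrite mem_cat eE.
have B : (exists2 i, i \in r & P i z) <-> (exists2 i, i \in r & P i w).
  by apply: FP => // e eE; apply: K; rewrite mem_cat eE orbT.
have C t : (exists2 j, j \in i :: r & P j t) <->
           P i t \/ exists2 j, j \in r & P j t.
  split.
    by move=> [j]; rewrite in_cons => /orP[/eqP->|]; [left|right; exists j].
  by move=> [?|[j jr ?]]; [exists i; rewrite ?mem_head|
    exists j; rewrite // in_cons jr orbT].
by rewrite !C A B.
Qed.

Lemma step_set_itv a b : step_set (fun w => a <= w < b).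
Proof.
exists [:: a; b] => z w zw H.
have Ha := H a (mem_head _ _); have Hb : (b <= z) = (b <= w).
  by apply: H; rewrite !inE eqxx orbT.
by rewrite Ha !ltNge Hb.
Qed.

End germs.

(** * One-sided branches, orbits and linear independence *)

Section branches.
Context {R : realType} (r : nat) (be ga : nat -> R).
Implicit Types (s : bool) (z w : R).

Definition is_partition : Prop :=
  [/\ be 0%N = 0, be r = 1 & forall j, (j < r)%N -> be j < be j.+1].

Definition independent : Prop := forall n m : nat -> int,
  \sum_(i < r) (n i)%:~R * ga i + \sum_(1 <= j < r) (m j)%:~R * be j = 0 ->
  (forall i, (i < r)%N -> n i = 0) /\ (forall j, (0 < j < r)%N -> m j = 0).

(** Branches are numbered from 0. With [s = false] a discontinuity belongs to the branch on its
    left, so that [tr false] is the left-continuous version of the map. *)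
Definition idx s z : nat := count (fun j => leg s (be j) z) (iota 1 r.-1).

Definition tr s z : R := z + ga (idx s z).

Lemma trE s z : tr s z = z + ga (idx s z).
Proof. by []. Qed.

Definition orb s n z : R := iter n (tr s) z.

Definition visits s z n (i : nat) : nat :=
  (\sum_(a < n) (idx s (orb s a z) == i))%N.

Lemma visitsE s z n i :
  visits s z n i = (\sum_(a < n) (idx s (orb s a z) == i))%N.
Proof. by []. Qed.

Context (part : is_partition).

Lemma r_gt0 : (0 < r)%N.
Proof.
case: part => b0 b1 _; rewrite lt0n; apply/eqP => r0.
by move: b1; rewrite r0 b0 => /eqP; rewrite eq_sym oner_eq0.
Qed.

Lemma be_mono i j : (i <= j <= r)%N -> be i <= be j.
Proof.
case: part => _ _ blt /andP[]; elim: j => [|j ih]; first by rewrite leqn0 => /eqP->.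
rewrite leq_eqVlt => /orP[/eqP->//|]; rewrite ltnS => ij jr.
by apply: le_trans (ih ij (ltnW jr)) _; apply: ltW; exact: blt.
Qed.

Lemma leg_le s a b z : a <= b -> leg s b z -> leg s a z.
Proof. by case: s => /= ab; [apply: le_trans|apply: le_lt_trans]. Qed.

Lemma idx_lt s z : (idx s z < r)%N.
Proof.
rewrite (leq_ltn_trans (count_size _ _))// size_iota.
by have := r_gt0; lia.
Qed.

Lemma leq_idx s z j : (0 < j < r)%N -> (j <= idx s z)%N = leg s (be j) z.
Proof.
move=> jr; apply: (@count_iota_down (fun j => leg s (be j) z)); last by lia.
by move=> i ir; apply: leg_le; apply: be_mono; lia.
Qed.

Lemma idx_eq s z w : (forall j, (0 < j < r)%N -> leg s (be j) z = leg s (be j) w) ->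
  idx s z = idx s w.
Proof. by move=> H; apply: eq_in_count => j; rewrite mem_iota => jr; apply: H; lia. Qed.

Lemma idx_sides z : (forall j, (0 < j < r)%N -> z <> be j) ->
  idx true z = idx false z.
Proof.
move=> H; apply: eq_in_count => j; rewrite mem_iota => jr /=.
by rewrite le_eqVlt; case: eqP => // /esym/H; case; lia.
Qed.

Lemma tr_sides s s' z : (forall j, (0 < j < r)%N -> z <> be j) ->
  tr s z = tr s' z.
Proof.
by move=> /idx_sides H; case: s; case: s' => //; rewrite /tr H.
Qed.

Lemma germ_idx s z : germ s z (fun w => idx true w = idx s z).
Proof.
have H : germ s z (fun w => forall j, j \in iota 1 r.-1 ->
    (be j <= w) = leg s (be j) z).
  by apply: germ_all => j _; exact: germ_leg.
by apply: germS H => w Hw; apply: eq_in_count => j jr; exact: Hw.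
Qed.

Lemma step_idx i : step_set (fun w => idx true w = i).
Proof.
exists (map be (iota 1 r.-1)) => z w zw H.
by rewrite (_ : idx true z = idx true w)//; apply: eq_in_count => j jr;
  apply: H; rewrite map_f.
Qed.

Lemma orbS s n z : orb s n.+1 z = tr s (orb s n z).
Proof. by []. Qed.

Lemma orbD s m n z : orb s (m + n) z = orb s m (orb s n z).
Proof. exact: iterD. Qed.

Lemma orb_visits s n z :
  orb s n z = z + \sum_(i < r) (visits s z n i)%:R * ga i.
Proof.
elim: n => [|n ih].
  by rewrite big1 ?addr0// => i _; rewrite /visits big_ord0 mul0r.
rewrite orbS /tr {1}ih -addrA; congr +%R.
rewrite -[ga _](_ : \sum_(i < r) (idx s (orb s n z) == i)%:R * ga i = _).
  rewrite -big_split/=; apply: eq_bigr => i _.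
  by rewrite /visits big_ord_recr/= natrD mulrDl.
rewrite (bigD1 (Ordinal (idx_lt s (orb s n z))))//= eqxx mul1r big1 ?addr0//.
move=> i ni; rewrite (_ : _ == _ = false) ?mul0r//.
by apply/negbTE; apply: contra ni => /eqP h; apply/eqP/val_inj.
Qed.

Lemma sum_visits s n z : (\sum_(i < r) visits s z n i)%N = n.
Proof.
rewrite /visits exchange_big/= -[RHS]card_ord -sum1_card; apply: eq_bigr => a _.
rewrite (bigD1 (Ordinal (idx_lt s (orb s a z))))//= eqxx big1// => i ni.
by apply/eqP; rewrite eqb0; apply: contra ni => /eqP h; apply/eqP/val_inj.
Qed.

Context (ind : independent).

(** By [orb_visits] each side is a discontinuity plus an integer combination of the translations, so
    independence equates all coefficients. The times agree because visits sum to the time. *)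
Lemma orb_meet s s' n n' c d : (0 < c < r)%N -> (0 < d < r)%N ->
  orb s n (be c) = orb s' n' (be d) ->
  [/\ c = d, n = n' & forall i, (i < r)%N ->
    visits s (be c) n i = visits s' (be d) n' i].
Proof.
move=> cr dr; rewrite !orb_visits => E.
pose N i : int := (visits s (be c) n i)%:Z - (visits s' (be d) n' i)%:Z.
pose M (j : nat) : int := (j == c)%:Z - (j == d)%:Z.
have S x : (0 < x < r)%N -> \sum_(1 <= j < r) (j == x)%:Z%:~R * be j = be x.
  move=> xr; rewrite (bigD1_seq x)/= ?iota_uniq ?mem_index_iota//.
  rewrite eqxx mul1r big1 ?addr0// => j /negbTE->.
  by rewrite mul0r.
have [|N0 M0] := @ind N M.
  rewrite (eq_bigr (fun i : 'I_r => (visits s (be c) n i)%:R * ga i -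
      (visits s' (be d) n' i)%:R * ga i)); last first.
    by move=> i _; rewrite /N rmorphB/= mulrBl.
  rewrite (eq_bigr (fun j : nat => (j == c)%:Z%:~R * be j -
      (j == d)%:Z%:~R * be j)); last first.
    by move=> i _; rewrite /M rmorphB/= mulrBl.
  by rewrite !sumrB !S//; move: E; lra.
have V i : (i < r)%N -> visits s (be c) n i = visits s' (be d) n' i.
  by move=> /N0; rewrite /N => /eqP; rewrite subr_eq0 => /eqP[].
split=> //.
  by have := M0 c cr; rewrite /M eqxx; case: eqP.
rewrite -(sum_visits s n (be c)) -(sum_visits s' n' (be d)).
by apply: eq_bigr => i _; exact: V.
Qed.

(** The displacement over a period is a vanishing combination of the translations whose coefficients
    are visit counts with sum [n]. *)
Lemma orb_aperiodic s n z : orb s n z = z -> n = 0%N.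
Proof.
rewrite orb_visits => /eqP; rewrite -subr_eq0 addrAC subrr add0r => /eqP E.
have [|N0 _] := @ind (fun i => (visits s z n i)%:Z) (fun _ => 0).
  by rewrite [X in _ + X]big1 ?addr0// => j _; rewrite mul0r.
rewrite -(sum_visits s n z) big1// => i _.
by have := N0 i (ltn_ord i); case.
Qed.

End branches.

(** * The map on germs of [X] and chains of endpoints *)

Section chains.
Context {R : realType} (r : nat) (be ga : nat -> R) (X : set R).
Implicit Types (s : bool) (z w : R).
Local Notation tr := (tr r be ga).
Local Notation idx := (idx r be).
Local Notation orb := (orb r be ga).

Definition bijective_system : Prop :=
  [/\ step_set X, X `<=` `[0, 1[, X = tr true @` X
    & {in X &, injective (tr true)}].

Definition inner z : Prop := germ true z X /\ germ false z X.

(** For [s = true] these are the left ends of [X], for [s = false] the right ends. *)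
Definition endpoint s z : Prop := germ s z X /\ ~ germ (~~ s) z X.

Context (part : is_partition r be) (sys : bijective_system).

Lemma tr_inj z w : X z -> X w -> tr true z = tr true w -> z = w.
Proof. by case: sys => _ _ _ H /mem_set Xz /mem_set Xw; exact: H. Qed.

Lemma tr_in z : X z -> X (tr true z).
Proof. by case: sys => _ _ E _ Xz; rewrite E; exists z. Qed.

Lemma sysP z : X z <-> germ true z X.
Proof. by case: sys => sX _ _ _; exact: step_at. Qed.

Lemma germ_tr s z : germ s z X -> germ s (tr s z)
  (fun w => X w /\ X (w - ga (idx s z)) /\ tr true (w - ga (idx s z)) = w).
Proof.
move=> gX; have := germ_shift (ga (idx s z)) (germI gX (germ_idx r be s z)).
apply: germS => w [Xw iw].
have E : tr true (w - ga (idx s z)) = w by rewrite !trE iw subrK.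
by split=> //; rewrite -E; exact: tr_in.
Qed.

Lemma germ_trX s z : germ s z X -> germ s (tr s z) X.
Proof. by move=> /germ_tr; apply: germS => w []. Qed.

Lemma germ_orb s n z : germ s z X -> germ s (orb s n z) X.
Proof. by elim: n => [//|n ih] /ih; exact: germ_trX. Qed.

(** A point near the common image has a preimage in [X] near [z] and one near [w]; they coincide, so
    both germs are moved by the same translation. *)
Lemma germ_tr_inj s z w : germ s z X -> germ s w X -> tr s z = tr s w -> z = w.
Proof.
move=> /germ_tr gz /germ_tr gw E; rewrite -E in gw.
have [t [[_ [Xz Ez]] [_ [Xw Ew]]]] := germ_ex (germI gz gw).
have /addrI/oppr_inj g : t - ga (idx s z) = t - ga (idx s w).
  by apply: tr_inj => //; rewrite Ez Ew.
by move: E; rewrite !trE g => /addIr.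
Qed.

(** Each [P i] is a step set, so if no single branch covered the germ at [z], some germ at [z] would
    miss them all, although [X] is its own image. *)
Lemma germ_tr_surj s z : germ s z X -> exists2 p, germ s p X & tr s p = z.
Proof.
case: sys => sX _ XE _ gz.
pose P i w := X (w - ga i) /\ idx true (w - ga i) = i.
have sP i : step_set (P i).
  exact: (step_set_shift (ga i) (step_setI sX (step_idx r be i))).
have [[i ir gP]|noP] := pselect (exists2 i, (i < r)%N & germ s z (P i)).
  have gQ : germ s (z - ga i) (X `&` [set w | idx true w = i]).
    by apply: germS (germ_shift (- ga i) gP) => w; rewrite /P opprK addrK.
  exists (z - ga i); first by apply: germS gQ => w [].
  have [w [[_ wi] wz]] := germ_ex (germI gQ (germ_idx r be s (z - ga i))).
  by rewrite !trE -wz wi subrK.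
have gN : germ s z (fun w => forall i, i \in iota 0 r -> ~ P i w).
  apply: germ_all => i; rewrite mem_iota => /andP[_ ir].
  have [gP|//] := step_germ s z (sP i).
  by case: noP; exists i.
have [w [Xw NPw]] := germ_ex (germI gz gN).
move: (Xw); rewrite XE => -[p Xp pw].
case: (NPw (idx true p)); first by rewrite mem_iota idx_lt.
by rewrite /P -pw trE addrK.
Qed.

Lemma orb_inj s m n z w : germ s z X -> germ s w X -> (m <= n)%N ->
  orb s m z = orb s n w -> z = orb s (n - m) w.
Proof.
move=> gz gw; elim: m n => [|m ih] [|n]//=; rewrite ?ltnS.
move=> mn E; rewrite subSS; apply: ih => //.
by apply: germ_tr_inj E; exact: germ_orb.
Qed.

Lemma endpoint_finite :
  exists E : seq R, forall s z, endpoint s z -> z \in E.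
Proof.
case: sys => -[E EX] _ _ _; exists E => s z [gz ngz]; apply: contrapT => /negP zE.
have {}EX : germ true z (fun w => X w <-> X z) /\ germ false z (fun w => X w <-> X z).
  have H s' : germ s' z (fun w => forall e, e \in E -> (e <= w) = leg s' e z).
    by apply: germ_all => e _; exact: germ_leg.
  have K s' : germ s' z (fun w => forall e, e \in E -> (e <= w) = (e <= z)).
    apply: germS (H s') => w Hw e eE; rewrite Hw//.
    case: s' {Hw} => //=; rewrite lt_neqAle; case: eqP => // ez.
    by move: zE; rewrite -ez eE.
  have L s' : germ s' z (fun w => X w <-> X z).
    apply: germS (K s') => w Hw; have [zw|/ltW wz] := leP z w.
      by apply: iff_sym; apply: EX => // e eE; rewrite Hw.
    by apply: EX => // e eE; rewrite Hw.
  by split.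
have L s' : germ s' z (fun w => X w <-> X z) by case: s' EX => -[].
apply: ngz; apply: germS (L (~~ s)) => w Xw; apply/Xw.
by have [t [Xt [h _]]] := germ_ex (germI gz (L s)); exact: h.
Qed.

Context (ind : independent r be ga).

(** A chain longer than the finite list of endpoints visits one of them twice, against aperiodicity.
    This form bounds backward chains that end at [z]. *)
Lemma endpoint_orb_pigeonhole s z :
  ~ (forall n, exists p, endpoint s p /\ (orb s n p = z /\
     forall m, (m <= n)%N -> endpoint s (orb s m p))).
Proof.
move=> H; have [E EP] := endpoint_finite.
have [p [_ [_ pE]]] := H (size E).
have [|i [j [ij]]] := @pigeonhole_seq _ E (fun n => orb s n p).
  by move=> n nE; apply: (EP s); exact: pE.
move=> Eij; have Ep : orb s (j - i) (orb s i p) = orb s i p.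
  by rewrite -orbD subnK//; lia.
by have := orb_aperiodic part ind Ep; lia.
Qed.

Lemma endpoint_exit s z : exists n, ~ endpoint s (orb s n z).
Proof.
apply: contrapT => H; have {}H n : endpoint s (orb s n z).
  by apply: contrapT => K; apply: H; exists n.
have [E EP] := endpoint_finite.
have [|i [j [ij]]] := @pigeonhole_seq _ E (fun n => orb s n z).
  by move=> n nE; exact: (EP s).
move=> Eij; have Ep : orb s (j - i) (orb s i z) = orb s i z.
  by rewrite -orbD subnK//; lia.
by have := orb_aperiodic part ind Ep; lia.
Qed.

(* The two sides of an inner discontinuity [be c] are torn apart by the map:
   until time [k] their germs run along endpoints of [X]. *)
Definition torn s c k : Prop :=
  [/\ (0 < c < r)%N, inner (be c), (0 < k)%N
    & forall m, (0 < m < k)%N -> endpoint s (orb s m (be c))].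

(** If [p] were neither an endpoint nor a discontinuity, both of its germs would be carried to [z]
    by the same translation, putting the other side of [z] into [X]. *)
Lemma pred_endpoint s p z : germ s p X -> tr s p = z -> ~ germ (~~ s) z X ->
  endpoint s p \/ exists c, torn s c 1 /\ p = be c.
Proof.
move=> gp pz nz; have [gp'|] := pselect (germ (~~ s) p X); last by left.
have [[c cr pc]|npc] := pselect (exists2 c, (0 < c < r)%N & p = be c).
  right; exists c; split=> //; split=> //; last by case=> [|[]].
  by rewrite -pc; split; case: s gp gp' {pz nz}.
case: nz; rewrite -pz (@tr_sides _ _ _ _ s (~~ s)); first exact: germ_trX.
by move=> j jr pj; apply: npc; exists j.
Qed.

(** Going backward from [z], the predecessors are endpoints until an inner discontinuity is reached,
    which the pigeonhole argument forces. The bound [k.+2] records that [z] itself is an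
    endpoint. *)
Lemma endpoint_torn s z : endpoint s z ->
  exists c k, torn s c k.+1 /\ orb s k.+1 (be c) = z /\ torn s c k.+2.
Proof.
move=> ez; apply: contrapT => H.
apply: (@endpoint_orb_pigeonhole s z); elim=> [|n [p [ep [pz pe]]]].
  by exists z; do 2 split=> //; case.
have [q gq qp] := germ_tr_surj ep.1.
have [eq|[c [[cr ic _ _] qc]]] := pred_endpoint gq qp ep.2.
  exists q; split=> //; split; first by rewrite -[n.+1]addn1 orbD /= qp.
  by case=> // m mn; rewrite -addn1 orbD/= qp; exact: pe.
have pe' m : (0 < m < n.+2)%N -> endpoint s (orb s m (be c)).
  by case: m => // m mn; rewrite -addn1 orbD/= -qc qp; exact: pe.
case: H; exists c, n; split; last split.
- by split=> // m mn; apply: pe'; lia.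
- by rewrite -addn1 orbD/= -qc qp.
- by split.
Qed.

End chains.

(** * Rejoining of torn orbits and the balance of their counts *)

Section components.
Context {R : realType} (r : nat) (be ga : nat -> R) (X : set R).
Implicit Types (s : bool) (z w : R).
Local Notation tr := (tr r be ga).
Local Notation idx := (idx r be).
Local Notation orb := (orb r be ga).
Local Notation visits := (visits r be ga).
Local Notation torn := (torn r be ga X).
Local Notation endpoint := (endpoint X).
Local Notation inner := (inner X).
Context (part : is_partition r be) (sys : bijective_system r be ga X)
  (ind : independent r be ga).

Definition rejoin c k : Prop :=
  [/\ forall s, torn s c k, inner (orb true k (be c)),
      orb true k (be c) = orb false k (be c)
    & forall i, (i < r)%N -> visits true (be c) k i = visits false (be c) k i].

(** The left germ at the inner point [z] reached by the right orbit has a predecessor [p]. Tracing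
    [p] back puts [z] on the left orbit of some discontinuity [d], and [orb_meet] gives [d = c] and
    equal times. *)
Lemma torn_rejoin c k : torn true c k -> inner (orb true k (be c)) -> rejoin c k.
Proof.
move=> tc ik; have [cr ic k0 te] := tc; set z := orb true k (be c).
have [p gp pz] := germ_tr_surj part sys ik.2.
have [d [k' [td dz]]] : exists d k', torn false d k' /\ orb false k' (be d) = z.
  (* If [p] is a right end, [endpoint_torn] applies; if it is an inner discontinuity, the left orbit
     starts there. Otherwise both one-sided maps send [p] to [z], so [p] is the previous point of
     the right orbit: either [be c] or a left end, and both are excluded. *)
  have [gp'|ngp] := pselect (germ true p X); last first.
    have [d [k' [_ [dp td]]]] := endpoint_torn part sys ind (conj gp ngp).
    by exists d, k'.+2; split=> //; rewrite orbS dp.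
  have [[d dr pd]|npd] := pselect (exists2 d, (0 < d < r)%N & p = be d).
    exists d, 1%N; rewrite /= -pd; split=> //; split=> //; last by case=> [|[]].
    by rewrite -pd.
  have tp : tr true p = z.
    rewrite -[RHS]pz; apply: tr_sides => j jr pj; apply: npd; by exists j.
  have E : p = orb true k.-1 (be c).
    apply: (germ_tr_inj sys gp'); first exact: (germ_orb sys _ ic.1).
    by rewrite tp /z -{1}(prednK k0).
  have [k1|k1] := posnP k.-1.
    by case: npd; exists c => //; rewrite E k1.
  have := te k.-1; rewrite -E => -[|_]; first by lia.
  by case.
have [dc kk V] := orb_meet part ind cr (let: And4 a _ _ _ := td in a) (esym dz).
by subst d k'; split=> //; case.
Qed.

(** Take for [k] the first positive time at which the right orbit is not at an endpoint; its right
    germ still lies in [X], so the point is inner. *)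
Lemma rejoin_ex c : (0 < c < r)%N -> inner (be c) -> exists k, rejoin c k.
Proof.
move=> cr ic.
have [n nE] := endpoint_exit part sys ind true (tr true (be c)).
have ex : exists n, (0 < n)%N && `[< ~ endpoint true (orb true n (be c)) >].
  exists n.+1; apply/andP; split=> //; apply/asboolP.
  by rewrite -addn1 orbD.
have [k /andP[k0 /asboolP kE] kmin] := ex_minnP ex; exists k.
apply: torn_rejoin.
  split=> // m /andP[m0 mk]; apply: contrapT => mE.
  by have := kmin m; rewrite m0/= asboolT// => /(_ isT); rewrite leqNgt mk.
have g : germ true (orb true k (be c)) X by exact: (germ_orb sys _ ic.1).
by split=> //; apply: contrapT => ng; apply: kE.
Qed.

Lemma torn_unique s s' c c' m m' k k' : torn s c k -> torn s' c' k' ->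
  orb s m (be c) = orb s' m' (be c') -> c = c'.
Proof. by move=> [cr _ _ _] [cr' _ _ _] /(orb_meet part ind cr cr')[]. Qed.

Lemma germ_unit s z : germ s z X ->
  0 <= z <= 1 /\ (if s then z < 1 else 0 < z).
Proof.
case: sys => _ X01 _ _.
have {}X01 w : X w -> 0 <= w < 1 by move/X01; rewrite /= in_itv.
case: s => [/germ_at/X01|] /=; first by lra.
move=> [e e0 eX].
have z1 : z <= 1.
  rewrite leNgt; apply/negP => z1; pose m := Num.max (z - e) 1.
  have mz : m < z by rewrite gt_max; lra.
  have em : z - e <= m by rewrite le_max lexx.
  have m1 : 1 <= m by rewrite le_max lexx orbT.
  have := X01 _ (eX ((m + z) / 2) _); lra.
have z0 : 0 < z.
  have := X01 _ (eX (z - e / 2) _); lra.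
by lra.
Qed.

Lemma be_idx s z : germ s z X -> be (idx s z) <= z <= be (idx s z).+1.
Proof.
move=> /germ_unit[/andP[z0 z1] zs]; have ir := idx_lt part s z.
have [b0 b1 _] := part.
apply/andP; split.
  have [->|i0] := posnP (idx s z); first by rewrite b0.
  have := @leq_idx _ _ _ part s z (idx s z); rewrite leqnn i0 => /(_ ir).
  by case: s {zs ir i0} => //= /esym/ltW.
have [->|i1] := eqVneq (idx s z).+1 r; first by rewrite b1.
have := @leq_idx _ _ _ part s z (idx s z).+1; rewrite ltnn => H.
have {H}/negbT := esym (H ltac:(lia)).
by case: s {zs ir i1} => /=; rewrite -?ltNge -?leNgt// => /ltW.
Qed.

Lemma idx_true_eq i z : (i < r)%N -> be i <= z < be i.+1 -> idx true z = i.
Proof.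
move=> ir /andP[iz zi]; apply/eqP; rewrite eqn_leq; apply/andP; split.
  rewrite leqNgt; apply/negP => H; have := idx_lt part true z => I.
  have := @leq_idx _ _ _ part true z i.+1; rewrite H => /(_ ltac:(lia))/esym/=.
  by rewrite leNgt zi.
have [->//|i0] := posnP i.
by rewrite (@leq_idx _ _ _ part)//; lia.
Qed.

(* With [u_a], [w_a] the two torn orbits of [be c], the function counting
   [u_a <= z] minus [w_a <= z] is invariant under the transfer operator of the
   map, since the orbits start and end together and visit each branch equally
   often; so its support is contained in its own image. *)
Definition passed s c k z : nat := (\sum_(a < k) (orb s a (be c) <= z)%R)%N.

(** The sum over times 0 to [k] is split at its last term on one side and at its first on the other;
    the remaining terms are pulled back one step and sorted by branch. *)
Lemma passed_shift s c k z :
  (passed s c k z + (orb s k (be c) <= z)%R =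
   (be c <= z)%R + \sum_(i < r) \sum_(a < k)
     ((idx s (orb s a (be c)) == i) && (orb s a (be c) <= z - ga i)%R))%N.
Proof.
transitivity (\sum_(a < k.+1) (orb s a (be c) <= z)%R)%N.
  by rewrite big_ord_recr.
rewrite big_ord_recl; congr addn; rewrite exchange_big.
apply: eq_bigr => a _; rewrite lift0 orbS trE -lerBrDr.
rewrite (bigD1 (Ordinal (idx_lt part s (orb s a (be c)))))//= eqxx/= big1 ?addn0//.
move=> i ni; rewrite (_ : _ == _ = false)//.
by apply/negbTE; apply: contra ni => /eqP h; apply/eqP/val_inj.
Qed.

Lemma rejoin_germ s c k a : rejoin c k -> germ s (orb s a (be c)) X.
Proof.
move=> [/(_ true)[_ [ic1 ic2] _ _] _ _ _].
by apply: (germ_orb sys); case: s.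
Qed.

(** For [z] in branch [i], all orbit points in earlier branches lie at or below [z], and none in
    later branches does. *)
Lemma passed_branch s c k i z : rejoin c k -> (i < r)%N -> be i <= z < be i.+1 ->
  passed s c k z = (\sum_(j < i) visits s (be c) k j + \sum_(a < k)
     ((idx s (orb s a (be c)) == i) && (orb s a (be c) <= z)%R))%N.
Proof.
move=> rj ir /andP[iz zi]; rewrite /passed.
under [X in _ = (X + _)%N]eq_bigr do rewrite visitsE.
rewrite exchange_big -big_split/=.
apply: eq_bigr => a _; have /be_idx/andP := @rejoin_germ s c k a rj.
set w := orb s a (be c); set j := idx s w => -[jw wj].
have jr : (j < r)%N by exact: idx_lt.
have -> : (\sum_(l < i) (j == l) = (j < i))%N.
  have [ji|ij] := ltnP j i.
    rewrite (bigD1 (Ordinal ji))//= eqxx big1// => l nl; apply/eqP.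
    by rewrite eqb0; apply: contra nl => /eqP h; apply/eqP/val_inj.
  by rewrite big1// => l _; apply/eqP; rewrite eqb0; have := ltn_ord l; lia.
have [ji|] := ltnP j i.
  rewrite (ltn_eqF ji)/= (le_trans wj)//; apply: le_trans iz.
  by apply: (be_mono part); lia.
rewrite leq_eqVlt => /orP[/eqP ->|ij]; first by rewrite eqxx.
rewrite (gtn_eqF ij)/=; apply/eqP; rewrite eqb0 -ltNge.
apply: lt_le_trans zi _; apply: le_trans jw.
by apply: (be_mono part); lia.
Qed.

Context (maxX : forall N, N `<=` `[0, 1[ -> N `<=` tr true @` N -> N `<=` X).

(** The unbalanced points form a set inside its own image: if no unbalanced point maps to [z], the
    sums in [passed_shift] agree branch by branch, and [z] is balanced. Maximality of [X] then
    applies. *)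
Lemma imbalance_sub c k z : rejoin c k ->
  passed true c k z <> passed false c k z -> X z.
Proof.
move=> rj; apply: (maxX (N := [set z | passed true c k z <> passed false c k z])).
  move=> {}z /= nz; rewrite in_itv/=; apply/negPn/negP => hz; apply: nz.
  have U s a : 0 <= orb s a (be c) <= 1.
    by have [] := germ_unit (rejoin_germ s a rj).
  apply: eq_bigr => a _; congr nat_of_bool.
  have := U true a; have := U false a.
  by move=> h1 h2; apply/idP/idP => h; lra.
move=> {}z /= nz; apply: contrapT => noP; apply: nz.
have [_ _ E V] := rj.
have := passed_shift true c k z; have := passed_shift false c k z; rewrite E.
suff -> : (\sum_(i < r) \sum_(a < k)
     ((idx true (orb true a (be c)) == i) && (orb true a (be c) <= z - ga i)%R))%N
   = (\sum_(i < r) \sum_(a < k)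
     ((idx false (orb false a (be c)) == i) && (orb false a (be c) <= z - ga i)%R))%N.
  by move=> <- /eqP; rewrite eqn_add2r => /eqP.
apply: eq_bigr => i _; set p := z - ga i.
(* If [p] is left of branch [i], nothing is counted; if it is to the right, all visits are, and they
   are equally many for both orbits. Inside the branch, [p] is a true preimage of [z]. *)
have [pi|ip] := ltP p (be i).
  have Z s : (\sum_(a < k) ((idx s (orb s a (be c)) == i) &&
      (orb s a (be c) <= p)%R) = 0)%N.
    rewrite big1// => a _; apply/eqP; rewrite eqb0; apply/negP => /andP[/eqP ia].
    have /be_idx := @rejoin_germ s c k a rj; rewrite ia; lra.
  by rewrite !Z.
have [ip'|pi] := leP (be i.+1) p.
  have Z s : (\sum_(a < k) ((idx s (orb s a (be c)) == i) && (orb s a (be c) <= p)%R)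
      = visits s (be c) k i)%N.
    apply: eq_bigr => a _; congr nat_of_bool.
    case: eqP => //= ia.
    by have /be_idx := @rejoin_germ s c k a rj; rewrite ia; lra.
  by rewrite !Z; exact: V.
have {}ip : be i <= p < be i.+1 by rewrite ip.
have Ep : passed true c k p = passed false c k p.
  apply: contrapT => np; apply: noP; exists p => //.
  by rewrite trE (idx_true_eq _ ip)// subrK.
move: Ep; rewrite !(passed_branch _ rj _ ip)//.
rewrite (eq_bigr (fun j : 'I_i => visits false (be c) k j)).
  by move/eqP; rewrite eqn_add2l => /eqP.
by move=> j _; apply: V; rewrite (ltn_trans (ltn_ord j)).
Qed.

End components.

(** * One discontinuity per component, and one-sided return times *)

Section return_map.
Context {R : realType} (r : nat) (be ga : nat -> R) (X : set R).
Implicit Types (s : bool) (z w : R).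
Local Notation tr := (tr r be ga).
Local Notation orb := (orb r be ga).
Local Notation torn := (torn r be ga X).
Local Notation rejoin := (rejoin r be ga X).
Local Notation endpoint := (endpoint X).
Local Notation inner := (inner X).
Local Notation passed := (passed r be ga).
Context (part : is_partition r be) (sys : bijective_system r be ga X)
  (ind : independent r be ga)
  (maxX : forall N, N `<=` `[0, 1[ -> N `<=` tr true @` N -> N `<=` X).
Context (x y : R) (xy : x < y) (JX : forall w, x <= w < y -> X w)
  (ex : endpoint true x) (ey : endpoint false y).

Lemma rejoin_endpoint s c k m : rejoin c k -> (0 < m < k)%N ->
  endpoint s (orb s m (be c)).
Proof. by move=> [/(_ s)[_ _ _ te] _ _ _]; exact: te. Qed.

(** The left end [x] lies on the right orbit of some [be c]. Were [y] not on its left orbit, then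
    passing from just left of [x] to [y], both outside [X], would raise the count of the right
    orbit, which contains [x], but not that of the left orbit, whose right ends avoid [[x, y]]. *)
Lemma component_torn : exists c k a b, [/\ rejoin c k, (0 < a < k)%N,
  (0 < b < k)%N, orb true a (be c) = x & orb false b (be c) = y].
Proof.
have [c [a [[cr ic _ _] [ax [_ _ _ ta]]]]] := endpoint_torn part sys ind ex.
have [k rj] := rejoin_ex part sys ind cr ic.
have ak : (a.+1 < k)%N.
  rewrite ltnNge; apply/negP => ka; have [/(_ true)[_ _ k0 _] [_ g] _ _] := rj.
  have [_] := ta k ltac:(lia); exact.
exists c, k, a.+1.
have [[b [bk by_]]|nb] := pselect (exists b, (0 < b < k)%N /\ orb false b (be c) = y).
  by exists b.
exfalso.
case: k rj ak nb => // k rj ak nb.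
have nXy : ~ X y by move/(sysP sys); case: ey.
have [x' [nXx' x'E]] : exists x', ~ X x' /\ forall s a, (a < k.+1)%N ->
    (orb s a (be c) <= x') = (orb s a (be c) < x).
  have G s : germ false x (fun w => forall a, a \in iota 0 k.+1 ->
      (orb s a (be c) <= w) = (orb s a (be c) < x)).
    by apply: germ_all => a' _; exact: (germ_leg false).
  have nG : germ false x (~` X).
    have [sX _ _ _] := sys.
    by have [gX|//] := step_germ false x sX; case: ex.
  have [w [nXw [Gt Gf]]] := germ_ex (germI nG (germI (G true) (G false))).
  exists w; split=> // s a' a'k.
  by case: s; [apply: Gt|apply: Gf]; rewrite mem_iota.
have bal z : ~ X z -> passed true c k.+1 z = passed false c k.+1 z.
  move=> nXz; apply: contrapT => ne; apply: nXz.
  exact: (imbalance_sub part sys maxX rj).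
have {bal} := (bal _ nXy, bal _ nXx') => -[].
(* The starting point [be c] is common to both orbits; cancelling it leaves endpoints only. *)
rewrite /passed !big_ord_recl.
move=> /eqP; rewrite eqn_add2l => /eqP By /eqP; rewrite eqn_add2l => /eqP.
have F s : (\sum_(i < k) (orb s (lift ord0 i) (be c) <= x')%R
    = \sum_(i < k) (orb s (lift ord0 i) (be c) < x)%R)%N.
  by apply: eq_bigr => i _; rewrite x'E// lift0 ltnS.
rewrite !F {F} => Bx; move: By.
have -> : (\sum_(i < k) (orb false (lift ord0 i) (be c) <= y)%R
    = \sum_(i < k) (orb false (lift ord0 i) (be c) < x)%R)%N.
  apply: eq_bigr => i _; congr nat_of_bool; rewrite lift0.
  have ik : (0 < i.+1 < k.+1)%N by have := ltn_ord i; lia.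
  have [ge ne] := rejoin_endpoint false rj ik.
  have {ne} nX : ~ X (orb false i.+1 (be c)) by move/(sysP sys).
  have ny : orb false i.+1 (be c) != y.
    by apply/eqP => E; apply: nb; exists i.+1.
  rewrite le_eqVlt (negbTE ny)/=; apply/idP/idP => h; last exact: lt_trans h xy.
  by rewrite ltNge; apply/negP => h'; apply: nX; apply: JX; rewrite h'.
rewrite -Bx; have ak' : (a < k)%N by lia.
move=> E; rewrite [LHS](bigD1 (Ordinal ak'))// [RHS](bigD1 (Ordinal ak'))// in E.
have lE : lift ord0 (Ordinal ak') = a.+1 :> nat by [].
move: E; rewrite !lE ax ltxx (ltW xy) => E.
suff : (\sum_(i < k | i != Ordinal ak') (orb true (lift ord0 i) (be c) < x)%R
   <= \sum_(i < k | i != Ordinal ak') (orb true (lift ord0 i) (be c) <= y)%R)%N.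
  have -> : (\sum_(i < k | i != Ordinal ak') (orb true (lift ord0 i) (be c) < x)%R
    = (\sum_(i < k | i != Ordinal ak')
        (orb true (lift ord0 i) (be c) <= y)%R).+1)%N by rewrite -[LHS]E.
  by rewrite ltnn.
apply: leq_sum => i _; case: ltP => // h.
by rewrite (ltW (lt_trans h xy)).
Qed.

(** In both cases the condition says that the germ of [z] on side [s] lies in [[x, y[]. *)
Definition inJ s z := if s then x <= z < y else x < z <= y.

Lemma germ_inJ s z : germ s z (fun w => (x <= w < y) = inJ s z).
Proof.
apply: germS (germI (germ_leg s x z) (germ_leg s y z)) => w [-> yw].
by rewrite ltNge yw; case: s {yw} => /=; rewrite -?ltNge -?leNgt.
Qed.

Lemma endpoint_inJ s z : endpoint s z -> inJ s z -> z = if s then x else y.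
Proof.
case: s => -[_ nz] /= /andP[z1 z2]; apply: contrapT => /eqP ne; apply: nz.
  exists (z - x) => [|w /andP[w1 w2]]; last by apply: JX; lra.
  by rewrite subr_gt0 lt_neqAle eq_sym ne.
apply/(sysP sys)/JX; rewrite (ltW z1)/=.
by rewrite lt_neqAle ne.
Qed.

Lemma inner_inJ z : inner z -> inJ true z = inJ false z.
Proof.
move=> [gt gf]; apply/idP/idP => /= /andP[z1 z2]; apply/andP; split.
- by rewrite lt_neqAle z1 andbT; apply/eqP => E; case: ex => _; rewrite E.
- exact: ltW.
- exact: ltW.
- by rewrite lt_neqAle z2 andbT; apply/eqP => E; case: ey => _; rewrite -E.
Qed.

Definition ret s z n : Prop := [/\ (0 < n)%N, inJ s (orb s n z)
  & forall m, (0 < m < n)%N -> ~ inJ s (orb s m z)].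

(** The two one-sided orbits separate only at a discontinuity. If it is not the one that produces
    [x] and [y], they rejoin without having met the component; if it is, the right orbit returns at
    [x] and the left one at [y]. *)
Lemma ret_sides z n : inner z -> ret true z n ->
  exists n', ret false z n' /\ (orb false n' z = orb true n z \/
    orb true n z = x /\ orb false n' z = y).
Proof.
have [c0 [k0 [a0 [b0 [rj0 a0k b0k xE yE]]]]] := component_torn.
elim/ltn_ind: n z => n ih z iz rz; have [n0 Jn nJ] := rz.
(* When both orbits meet at an inner point with no earlier visit, either this is the return or the
   induction hypothesis covers the remaining time. *)
have common k : (0 < k)%N -> orb true k z = orb false k z ->
    inner (orb true k z) -> (forall s m, (0 < m < k)%N -> ~ inJ s (orb s m z)) ->
    exists n', ret false z n' /\ (orb false n' z = orb true n z \/
      orb true n z = x /\ orb false n' z = y).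
  move=> k0' E ik nk; have kn : (k <= n)%N.
    by rewrite leqNgt; apply/negP => nk'; apply: (nk true n) Jn; rewrite n0.
  move: kn; rewrite leq_eqVlt => /orP[/eqP kn|kn].
    subst n; exists k; split; last by left.
    by split=> //; [rewrite -E -inner_inJ|move=> m; exact: nk].
  have [|//||n' [[n'0 Jn' nJ'] En']] := ih (n - k)%N _ (orb true k z).
  - lia.
  - split; [lia|by rewrite -orbD subnK// ltnW|].
    by move=> m mn; rewrite -orbD; apply: nJ; lia.
  exists (n' + k)%N; rewrite orbD -E -[in orb true n z](subnK (ltnW kn)) orbD.
  split=> //; split; [lia|by rewrite orbD -E|move=> m mn].
  have [mk|km] := ltnP m k; first by apply: nk; lia.
  have [<-|mk] := eqVneq k m; first by rewrite -E -inner_inJ//; apply: nJ; lia.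
  by rewrite -(subnK km) orbD -E; apply: nJ'; lia.
have [[c cr zc]|nc] := pselect (exists2 c, (0 < c < r)%N & z = be c); last first.
  have E : tr true z = tr false z.
    by apply: tr_sides => // j jr zj; apply: nc; exists j.
  apply: (common 1%N) => //=; last by move=> s [|[]].
  split; first exact: (germ_trX sys iz.1).
  by rewrite E; exact: (germ_trX sys iz.2).
have [k rj] : exists k, rejoin c k by apply: rejoin_ex => //; rewrite -zc.
have [cc|nc] := eqVneq c c0; last first.
  have [tk ik E _] := rj; have [_ _ k1 _] := tk true.
  rewrite zc in iz rz Jn nJ common *; apply: (common k) => // s m mk Jm.
  have := endpoint_inJ (rejoin_endpoint s rj mk) Jm.
  move/eqP: nc; case: s Jm => _ ncc h; apply: ncc.
    by rewrite -xE in h; apply: (torn_unique part ind (tk true) _ h); have [] := rj0.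
  by rewrite -yE in h; apply: (torn_unique part ind (tk false) _ h); have [] := rj0.
subst c; rewrite zc.
have na : n = a0.
  have [na|an|//] := ltngtP n a0.
    have nk : (0 < n < k0)%N by lia.
    move: Jn; rewrite zc => /(endpoint_inJ (rejoin_endpoint true rj0 nk)).
    by rewrite -xE => /(orb_meet part ind cr cr)[].
  by case: (nJ a0); [lia|rewrite zc xE /= lexx xy].
exists b0; rewrite na xE yE; split; last by right.
split; [lia|by rewrite yE /= lexx xy|move=> m mb Jm].
have mk : (0 < m < k0)%N by lia.
move: Jm => /(endpoint_inJ (rejoin_endpoint false rj0 mk)).
by rewrite -yE => /(orb_meet part ind cr cr)[]; lia.
Qed.

Lemma near_orb s z n : germ s z (fun w => forall m, m \in iota 0 n.+1 ->
  orb true m w = w + (orb s m z - z) /\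
  inJ true (orb true m w) = inJ s (orb s m z)).
Proof.
have H m : germ s z (fun w => orb true m w = w + (orb s m z - z)).
  elim: m => [|m ih]; first by apply: germS (germT s z) => w _ /=; lra.
  have g := germ_shift (z - orb s m z) (germ_idx r be s (orb s m z)).
  rewrite addrC subrK in g; apply: germS (germI ih g) => w [E].
  rewrite orbS trE [in orb _ m.+1 z]orbS trE E opprB => ->; lra.
apply: germ_all => m _.
have g := germ_shift (z - orb s m z) (germ_inJ s (orb s m z)).
rewrite addrC subrK in g; apply: germS (germI (H m) g) => w [E].
by rewrite E opprB /= => ->.
Qed.

Lemma near_ret s z n : ret s z n -> germ s z (fun w => ret true w n /\
  orb true n w = w + (orb s n z - z)).
Proof.
move=> [n0 Jn nJ]; apply: germS (near_orb s z n) => w H.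
have [|En JEn] := H n; first by rewrite mem_iota; lia.
split=> //; split=> //; first by rewrite JEn.
by move=> m mn; have [|_ ->] := H m; [rewrite mem_iota; lia|exact: nJ].
Qed.

End return_map.

(** * Real induction and recurrence *)

Section rotation.
Context {R : realType}.

(** Real induction, through the supremum of the points up to which [P] holds: [P] reaches it from
    the left and then extends past it. *)
Lemma interval_induction (x y : R) (P : set R) : P x ->
  (forall z, x <= z < y -> P z -> germ true z P) ->
  (forall z, x < z < y -> (forall w, x <= w < z -> P w) -> P z) ->
  forall z, x <= z < y -> P z.
Proof.
move=> Px Pr Pl z /andP[xz zy]; apply: contrapT => nPz.
pose S := [set w | x <= w <= z /\ forall t, x <= t <= w -> P t].
have Sx : S x.
  split=> [|t /andP[xt tx]]; first by rewrite lexx.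
  by have -> : t = x by apply/eqP; rewrite eq_le tx.
have hS : has_sup S by split; [exists x|exists z => w [/andP[]]].
have xs : x <= sup S by apply: ub_le_sup => //; case: hS.
have sz : sup S <= z by apply: ge_sup => [|w [/andP[]]//]; exists x.
have lo t : x <= t < sup S -> P t.
  move=> /andP[xt ts].
  have [|w [_ wP] tw] := @sup_adherent _ S (sup S - t) _ hS.
    by rewrite subr_gt0.
  by apply: wP; rewrite xt/= ltW// (le_lt_trans _ tw)//; lra.
have Ps : P (sup S).
  have [->//|xs'] := eqVneq (sup S) x.
  apply: Pl => //; rewrite (le_lt_trans sz zy) andbT.
  by rewrite lt_neqAle eq_sym xs'.
have [|e e0 eP] := Pr (sup S) _ Ps; first by rewrite xs (le_lt_trans sz).
have [sez|] := ltP z (sup S + e).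
  by apply: nPz; apply: eP; rewrite sz.
move=> ez; have : S (sup S + e / 2).
  split=> [|t /andP[xt te]]; first by lra.
  by have [ts|st] := ltP t (sup S); [apply: lo; rewrite xt|apply: eP; lra].
have [_ uS] := hS.
by move=> /(ub_le_sup uS); lra.
Qed.

Context (r : nat) (be ga : nat -> R) (X : set R).
Implicit Types (s : bool) (z w : R).
Local Notation tr := (tr r be ga).
Local Notation orb := (orb r be ga).
Local Notation endpoint := (endpoint X).
Context (part : is_partition r be) (sys : bijective_system r be ga X)
  (ind : independent r be ga)
  (maxX : forall N, N `<=` `[0, 1[ -> N `<=` tr true @` N -> N `<=` X).
Context (x y : R) (xy : x < y) (JX : forall w, x <= w < y -> X w)
  (ex : endpoint true x) (ey : endpoint false y).
Local Notation inJ := (inJ x y).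
Local Notation ret := (ret r be ga x y).

Lemma ret_min s z n : (0 < n)%N -> inJ s (orb s n z) -> exists k, ret s z k.
Proof.
move=> n0 Jn; have exn : exists n, (0 < n)%N && inJ s (orb s n z).
  by exists n; rewrite n0.
have [k /andP[k0 Jk] kmin] := ex_minnP exn.
exists k; split=> // m /andP[m0 mk] Jm.
by have := kmin m; rewrite m0 Jm leqNgt mk => /(_ isT).
Qed.

Lemma ret_uniq s z n k : ret s z n -> ret s z k -> n = k.
Proof.
move=> [n0 Jn nJ] [k0 Jk kJ]; have [nk|kn|//] := ltngtP n k.
  by case: (kJ n); rewrite ?n0.
by case: (nJ k); rewrite ?k0.
Qed.

Lemma JX_germ z : inJ true z -> germ true z X.
Proof. by move=> /JX /(sysP sys). Qed.

(** Only at such points can the iterates of a short interval be cut before it returns. *)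
Definition last_visit c w : Prop := inJ true w /\ exists n,
  orb true n w = be c /\ forall m, (0 < m <= n)%N -> ~ inJ true (orb true m w).

(** By injectivity one point lies on the forward orbit of the other, at a time when visits are
    forbidden unless that time is 0. *)
Lemma last_visit_uniq c w w' : last_visit c w -> last_visit c w' -> w = w'.
Proof.
move=> [Jw [n [nc nJ]]] [Jw' [n' [nc' nJ']]].
have key (u u' : R) k k' : inJ true u -> inJ true u' -> (k <= k')%N ->
    orb true k u = be c -> orb true k' u' = be c ->
    (forall m, (0 < m <= k')%N -> ~ inJ true (orb true m u')) -> u = u'.
  move=> Ju Ju' kk ku ku' nJu'.
  have := orb_inj sys (JX_germ Ju) (JX_germ Ju') kk; rewrite ku ku' => /(_ erefl).
  have [->//|d0 E] := posnP (k' - k)%N.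
  by case: (nJu' (k' - k)%N); [lia|rewrite -E].
have [nn|/ltnW nn] := leqP n n'; first exact: (key w w' n n').
by apply/esym; exact: (key w' w n' n).
Qed.

(** Were [z] never to return, a short interval [[z, z + e[] with no last visit except possibly [z]
    would be translated forever, uncut and without meeting the component. Two of its images overlap,
    and injectivity turns this into a return. *)
Lemma recurrence z : inJ true z -> exists n, ret true z n.
Proof.
move=> Jz; apply: contrapT => nret.
have H n : (0 < n)%N -> ~ inJ true (orb true n z).
  by move=> n0 Jn; apply: nret; exact: ret_min Jn.
have [e e0 eP] : germ true z (fun w => x <= w < y /\
    forall c, c \in iota 1 r.-1 -> w = z \/ ~ last_visit c w).
  apply: germI.
    by apply: germS (germ_inJ x y true z) => w ->.
  apply: germ_all => c _.
  have [[w0 [zw0 w0c]]|nw0] := pselect (exists w0, z < w0 /\ last_visit c w0).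
    exists (w0 - z) => [|w /andP[zw ww0]]; first by rewrite subr_gt0.
    right=> wc; have := last_visit_uniq w0c wc; move: ww0; lra.
  exists 1 => // w /andP[zw _]; have [->|wz] := eqVneq w z; first by left.
  right=> wc; apply: nw0; exists w; split=> //.
  by rewrite lt_neqAle zw andbT eq_sym.
have W n : forall w, z <= w < z + e -> orb true n w = w + (orb true n z - z) /\
    ((0 < n)%N -> ~ inJ true (orb true n w)).
  elim/ltn_ind: n => -[_ w _|n ih]; first by split=> //=; lra.
  have T1 w : z <= w < z + e -> orb true n.+1 w = w + (orb true n.+1 z - z).
    move=> zw; have [En _] := ih n (ltnSn n) w zw.
    have Ez : orb true n z <= orb true n w by rewrite En; lra.
    suff Ei : idx r be true (orb true n w) = idx r be true (orb true n z).
      by rewrite !orbS !trE Ei En; lra.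
    apply: idx_eq => j jr; rewrite /leg.
    apply/idP/idP => [bw|bz]; last exact: le_trans bz Ez.
    (* The point [w'] of the interval that is carried to the separating discontinuity would be a
       last visit. *)
    rewrite leNgt; apply/negP => zb; pose w' := be j - (orb true n z - z).
    have zw' : z < w' <= w by rewrite En in bw; rewrite /w'; lra.
    have ew' : z <= w' < z + e by lra.
    have [Jw' /(_ j (mem_iota1 jr))[w'z|[]]] := eP w' ew'; first by lra.
    split=> //; exists n; split.
      by have [-> _] := ih n (ltnSn n) w' ew'; rewrite /w'; lra.
    by move=> m /andP[m0 mn]; have [_] := ih m mn w' ew'; exact.
  move=> w zw; split; first exact: T1.
  move=> _ J1; have nJ := H n.+1 isT; rewrite (T1 _ zw) in J1.
  move: nJ J1; set u := orb true n.+1 z => nJ /andP[J1 J2].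
  (* The translated interval would cross [x] from the left, giving [X] a left germ at its left
     end. *)
  have zx : u < x.
    rewrite ltNge; apply/negP => xu; apply: nJ; rewrite /inJ xu/=.
    by apply: le_lt_trans J2; lra.
  case: ex => _ []; exists (x - u) => [|t /= /andP[t1 t2]].
    by rewrite subr_gt0.
  have ew' : z <= t - (u - z) < z + e by lra.
  have Et : orb true n.+1 (t - (u - z)) = t by rewrite T1// -/u subrK.
  rewrite -Et; apply/(sysP sys); apply: (germ_orb sys).
  by apply: JX_germ; have [] := eP _ ew'.
(* Iterates in the same cell of length [e] are closer than [e], so shifting [z] by their distance
   stays in the interval. *)
pose f n := Num.truncn (orb true n z / e).
have Xn n : 0 <= orb true n z <= 1.
  by have [] := germ_unit sys (germ_orb sys n (JX_germ Jz)).
have fP n : (f n)%:R <= orb true n z / e < (f n).+1%:R.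
  by apply: truncn_itv; apply: divr_ge0; [have /andP[] := Xn n|exact: ltW].
have [|i [j [ij fij]]] := @pigeonhole_seq _ (iota 0 (Num.truncn e^-1).+1) f.
  move=> n _; rewrite mem_iota/= ltnS; apply: le_truncn.
  by rewrite ler_pdivrMr// mulVf ?gt_eqF//; have /andP[] := Xn n.
have := fP i; have := fP j; rewrite -fij => /andP[j1 j2] /andP[i1 i2].
rewrite -natr1 in i2 j2.
have gz := JX_germ Jz.
have [le|lt] := leP (orb true i z) (orb true j z).
  pose w := z + (orb true j z - orb true i z).
  have zw : z <= w < z + e.
    rewrite /w lerDl subr_ge0 le/= ltrD2l -[ltRHS]mul1r -ltr_pdivrMr// mulrBl.
    by lra.
  have Jw : inJ true w by have [] := eP w zw.
  have E : orb true i w = orb true j z.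
    by have [-> _] := W i w zw; rewrite /w; lra.
  have Ew := orb_inj sys (JX_germ Jw) gz _ E.
  apply: (H (j - i)%N); first by lia.
  by rewrite -Ew//; lia.
pose w := z + (orb true i z - orb true j z).
have zw : z <= w < z + e.
  rewrite /w lerDl subr_ge0 (ltW lt)/= ltrD2l -[ltRHS]mul1r -ltr_pdivrMr// mulrBl.
  by lra.
have Jw : inJ true w by have [] := eP w zw.
have E : orb true i z = orb true j w.
  by have [-> _] := W j w zw; rewrite /w; lra.
have Ew := orb_inj sys gz (JX_germ Jw) (_ : (i <= j)%N) E.
have [_ ] := W (j - i)%N w zw; rewrite -Ew; last by lia.
by move=> /(_ _); apply => //; lia.
Qed.

End rotation.

(** * The return map as an irrational rotation *)

Section rotation_angle.
Context {R : realType} (r : nat) (be ga : nat -> R) (X : set R).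
Implicit Types (s : bool) (z w : R).
Local Notation tr := (tr r be ga).
Local Notation orb := (orb r be ga).
Local Notation endpoint := (endpoint X).
Context (part : is_partition r be) (sys : bijective_system r be ga X)
  (ind : independent r be ga)
  (maxX : forall N, N `<=` `[0, 1[ -> N `<=` tr true @` N -> N `<=` X).
Context (x y : R) (xy : x < y) (JX : forall w, x <= w < y -> X w)
  (ex : endpoint true x) (ey : endpoint false y).
Local Notation inJ := (inJ x y).
Local Notation ret := (ret r be ga x y).

Lemma inJ_inner z : x < z < y -> inner X z.
Proof.
move=> /andP[xz zy]; split.
  by apply: (JX_germ sys JX); rewrite /= ltW.
exists (z - x) => [|w /andP[w1 w2]]; first by rewrite subr_gt0.
by apply: JX; lra.
Qed.

(** The displacement modulo the length is propagated from [x] by real induction: it is constant just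
    to the right of each point, and by [ret_sides] the two sides of a point differ by 0 or by the
    length. *)
Lemma ret_rotation : exists d, forall z n, inJ true z -> ret true z n ->
  exists m : int, orb true n z = z + d + m%:~R * (y - x).
Proof.
have Jx : inJ true x by rewrite /= lexx.
have [n0 rx] := recurrence sys xy JX ex Jx.
pose d := orb true n0 x - x; exists d.
pose P z := forall n, ret true z n ->
  exists m : int, orb true n z = z + d + m%:~R * (y - x).
suff : forall z, x <= z < y -> P z by move=> H z n Jz; exact: H.
apply: interval_induction.
- by move=> n /(ret_uniq rx) <-; exists 0; rewrite mul0r addr0 /d; lra.
- move=> z Jz Pz; have [n rz] := recurrence sys xy JX ex Jz.
  have [m Em] := Pz n rz.
  apply: germS (near_ret xy rz) => w [rw Ew] k /(ret_uniq rw) <-.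
  by exists m; rewrite Ew Em; lra.
- move=> z zJ Pz n rz.
  have [n' [rz' E]] := ret_sides part sys ind maxX xy JX ex ey (inJ_inner zJ) rz.
  have gx : germ false z (fun w => x <= w < z).
    exists (z - x); first by rewrite subr_gt0; case/andP: zJ.
    by move=> w /andP[w1 w2]; lra.
  have [w [xwz [rw Ew]]] := germ_ex (germI gx (near_ret xy rz')).
  have [m Em] := Pz w xwz n' rw.
  have Ez' : orb false n' z = z + d + m%:~R * (y - x) by rewrite Em in Ew; lra.
  case: E => [<-|[-> yE]]; first by exists m.
  exists (m - 1); rewrite rmorphB/= mulrBl mul1r.
  by rewrite yE in Ez'; lra.
Qed.

(** For a rational angle some iterate of the return map would move [x] by an integer multiple of the
    length, hence by 0, against aperiodicity. *)
Lemma ret_irrational d : (forall z n, inJ true z -> ret true z n ->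
    exists m : int, orb true n z = z + d + m%:~R * (y - x)) ->
  irrational (d / (y - x)).
Proof.
move=> rot /rationalP[a0 [b0 ab0]].
have yx0 : y - x != 0 by rewrite subr_eq0 gt_eqF.
(* The denominator from [rationalP] may be 0; the quotient is then 0 by convention, so [d = 0], and
   the pair 0, 1 serves. *)
have [a [b [bn0 ab]]] : exists (a : int) (b : nat),
    (0 < b)%N /\ b%:R * d = a%:~R * (y - x).
  have [b00|bn0] := posnP b0.
    exists 0, 1%N; split=> //; move/eqP: ab0.
    rewrite b00 invr0 mulr0 mulf_eq0 invr_eq0 (negbTE yx0) orbF => /eqP->.
    by rewrite mulr0 mul0r.
  exists a0, b0; split=> //.
  have bR : b0%:R != 0 :> R by rewrite pnatr_eq0 -lt0n.
  by rewrite -[d](divfK yx0) ab0; field.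
have iter_ret j : exists n, [/\ (j <= n)%N, inJ true (orb true n x) &
    exists m : int, orb true n x = x + j%:R * d + m%:~R * (y - x)].
  elim: j => [|j [n [jn Jn [m Em]]]].
    by exists 0%N; split=> //=; [rewrite lexx|exists 0; rewrite !mul0r !addr0].
  have [k rk] := recurrence sys xy JX ex Jn.
  have [m' Em'] := rot _ _ Jn rk; have [k0 Jk _] := rk.
  exists (k + n)%N; rewrite orbD; split=> //; first by lia.
  exists (m + m'); rewrite Em' Em rmorphD/= -natr1; lra.
have [n [bn Jn [m Em]]] := iter_ret b.
have E : orb true n x = x + (a + m)%:~R * (y - x) by rewrite Em ab rmorphD/=; lra.
have am0 : a + m = 0.
  move: Jn; rewrite /inJ E lerDl pmulr_lge0 ?subr_gt0// ler0z -ltrBrDl => /andP[am].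
  rewrite -[ltRHS]mul1r ltr_pM2r ?subr_gt0// -[1]/(1%:~R) ltr_int; lia.
have En : orb true n x = x by rewrite E am0 mul0r addr0.
by have := orb_aperiodic part ind En; lia.
Qed.

End rotation_angle.

(** * Lebesgue measure of images, and injectivity from surjectivity *)

Section lebesgue.
Context {R : realType}.
Local Notation mu := (@lebesgue_measure R).
Implicit Types A Y : set (measurableTypeR R).

Lemma measurable_fun_shift (c : R) : measurable_fun setT
  ((fun w => w - c) : measurableTypeR R -> measurableTypeR R).
Proof. by apply: measurable_funB; [exact: measurable_id|exact: measurable_cst]. Qed.

Lemma measurable_shift (c : R) A : measurable A ->
  measurable ((fun w : measurableTypeR R => w - c) @^-1` A : set (measurableTypeR R)).
Proof.
by move=> mA; rewrite -[X in measurable X]setTI; exact: measurable_fun_shift.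
Qed.

Lemma lebesgue_measure_shift (c : R) A : measurable A ->
  mu ((fun w : measurableTypeR R => w - c) @^-1` A) = mu A.
Proof.
move=> mA; rewrite -[LHS]/(pushforward mu
  ((fun w : measurableTypeR R => w - c) : _ -> measurableTypeR R) A).
apply/esym/lebesgue_measure_unique => //=.
  exact: measurable_fun_shift.
move=> mf _ [[a b]] _ <-; rewrite /pushforward.
rewrite (_ : _ @^-1` _ = `]a + c, b + c]%classic); last first.
  by apply/seteqP; split=> w; rewrite /= !in_itv/= ltrBrDr lerBlDr.
rewrite !lebesgue_measure_itv/= !lte_fin ltrD2r -!EFinD.
by case: ifP => // _; congr EFin; lra.
Qed.

Context (r : nat) (be ga : nat -> R) (part : is_partition r be).
Local Notation tr := (tr r be ga true).

Lemma idx_trueP z i : (i < r)%N -> 0 <= z < 1 ->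
  (idx r be true z = i) <-> be i <= z < be i.+1.
Proof.
move=> ir /andP[z0 z1]; split; last exact: idx_true_eq.
have [b0 b1 _] := part; move=> zi; apply/andP; split.
  have [->|i0] := posnP i; first by rewrite b0.
  by rewrite -[_ <= _](@leq_idx _ _ _ part true z i) ?zi// i0.
have [->|ir'] := eqVneq i.+1 r; first by rewrite b1.
rewrite ltNge -[be _ <= z](@leq_idx _ _ _ part true z i.+1) ?zi ?ltnn//.
by have := ir; rewrite leq_eqVlt (negbTE ir').
Qed.

Lemma tr_imageE Y : Y `<=` `[0, 1[ -> tr @` Y =
  \bigcup_(i < r) ((fun w => w - ga i) @^-1` (Y `&` `[be i, be i.+1[)).
Proof.
move=> Y01; apply/seteqP; split=> [_ [p Yp <-]|w [i ir [Yw]]].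
  exists (idx r be true p); first exact: (idx_lt part).
  rewrite /preimage/= trE addrK; split=> //; rewrite /= in_itv/=.
  by apply/idx_trueP => //; [exact: (idx_lt part)|move/Y01: Yp; rewrite /= in_itv].
rewrite /= in_itv/= => wi; exists (w - ga i) => //.
by rewrite trE (idx_true_eq part _ wi)// subrK.
Qed.

Lemma measurable_tr_image Y : measurable Y -> Y `<=` `[0, 1[ ->
  measurable (tr @` Y : set (measurableTypeR R)).
Proof.
move=> mY Y01; rewrite tr_imageE//; apply: bigcup_measurable => i _.
by apply: measurable_shift; apply: measurableI => //; exact: measurable_itv.
Qed.

(** The image is a union of translates of the pieces of [Y] in the branches; these may overlap, so
    subadditivity gives only an inequality. *)
Lemma lebesgue_tr_image_le Y : measurable Y -> Y `<=` `[0, 1[ ->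
  (mu (tr @` Y) <= mu Y)%E.
Proof.
move=> mY Y01; pose B i : set (measurableTypeR R) := Y `&` `[be i, be i.+1[%classic.
have mB i : measurable (B i) by apply: measurableI => //; exact: measurable_itv.
have -> : mu Y = (\sum_(i < r) mu (B i))%E.
  have -> : Y = \big[setU/set0]_(i < r) B i.
    rewrite -bigcup_mkord; apply/seteqP; split=> [p Yp|p [i _ []//]].
    exists (idx r be true p); first exact: (idx_lt part).
    split=> //; rewrite /= in_itv/=.
    by apply/idx_trueP => //; [exact: (idx_lt part)|move/Y01: Yp; rewrite /= in_itv].
  rewrite measure_bigsetU_ord//.
    move=> i j _ _ [w [[_ wi] [_ wj]]]; apply/val_inj.
    move: wi wj; rewrite /= !in_itv/= => wi wj.
    by rewrite -(idx_true_eq part _ wi)// -(idx_true_eq part _ wj).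
have le1 : (mu (tr @` Y) <= \sum_(i < r) mu ((fun w : R => w - ga i)%R @^-1` (B i)))%E.
  apply: (@content_subadditive _ _ _ mu _
    (fun i => (fun w : R => w - ga i) @^-1` (B i)) r) => [i _||].
  - exact: measurable_shift.
  - exact: measurable_tr_image.
  - by rewrite tr_imageE// bigcup_mkord.
apply: (le_trans le1).
by apply: lee_sum => i _; rewrite lebesgue_measure_shift.
Qed.

(* If two points of [X] had the same image then so would two disjoint
   intervals of [X], and [X] without one of them, which has smaller measure,
   would still be mapped onto [X]. *)
Lemma surjective_injective (X : set R) : step_set X -> X `<=` `[0, 1[ ->
  measurable (X : set (measurableTypeR R)) -> X = tr @` X ->
  {in X &, injective tr}.
Proof.
move=> sX X01 mX XE.
suff key p q : X p -> X q -> tr p = tr q -> p < q -> False.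
  move=> p q /set_mem Xp /set_mem Xq E.
  by have [/(key _ _ Xp Xq E)|/(key _ _ Xq Xp (esym E))|] := ltgtP p q.
move=> Xp Xq E pq.
pose G w z := X w /\ tr w = w + (tr z - z).
have gG z : X z -> germ true z (fun w => G w z).
  move=> /(step_at _ sX) Xz; apply: germS (germI Xz (germ_idx r be true z)).
  by move=> w [Xw iw]; split=> //; rewrite !trE iw; lra.
have [e e0 eP] := gG _ Xp; have [f f0 fP] := gG _ Xq.
(* The bound [q - p] keeps [[p, p + g[] disjoint from its translate at [q]. *)
pose g := Num.min (Num.min e f) (q - p).
have g0 : 0 < g by rewrite !lt_min e0 f0 subr_gt0.
have ge_ : g <= e by rewrite /g !ge_min lexx.
have gf : g <= f by rewrite /g !ge_min lexx orbT.
have gpq : g <= q - p by rewrite /g !ge_min lexx orbT.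
pose D : set (measurableTypeR R) := `[p, p + g[%classic.
have mD : measurable D by exact: measurable_itv.
have XD : X `&` D = D.
  apply/seteqP; split=> [w []//|w Dw]; split=> //; move: Dw.
  by rewrite /D/= in_itv/= => Dw; have [] : G w p by apply: eP; lra.
have mXD : measurable (X `\` D : set (measurableTypeR R)) by exact: measurableD.
have XD01 : X `\` D `<=` `[0, 1[ by move=> w [/X01].
have trXD : tr @` (X `\` D) = X.
  rewrite {2}XE; apply/seteqP; split=> [_ [w [Xw _] <-]|_ [w Xw <-]]; first by exists w.
  have [Dw|nDw] := pselect (D w); last by exists w.
  move: Dw; rewrite /D/= in_itv/= => Dw.
  have [_ Ew] : G w p by apply: eP; lra.
  have [Xw' Ew'] : G (w + (q - p)) q by apply: fP; lra.
  exists (w + (q - p)); last by rewrite Ew' Ew E; lra.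
  by split=> //; rewrite /D/= in_itv/=; apply/negP; rewrite negb_and -!ltNge -!leNgt; lra.
have mu01 : (mu X < +oo)%E.
  apply: (@le_lt_trans _ _ (mu (`[0, 1[%classic : set (measurableTypeR R)))).
    by apply: le_measure => //; rewrite inE//; exact: measurable_itv.
  by rewrite lebesgue_measure_itv/= lte_fin ltr01 -EFinD ltry.
have muD : mu D = g%:E.
  rewrite /D lebesgue_measure_itv/= lte_fin ltrDl g0 -EFinD.
  by congr EFin; lra.
have le : (mu X <= mu X - mu D)%E.
  have := lebesgue_tr_image_le mXD XD01.
  by rewrite trXD measureD// -[X in (_ - X)%E]/(mu (X `&` D)) XD.
have fX : mu X \is a fin_num by rewrite ge0_fin_numE.
by move: le; rewrite muD -(fineK fX) -EFinB lee_fin; lra.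
Qed.

End lebesgue.

(** * Rational hyperplanes are null *)

Section hyperplanes.
Context {R : realType}.
Implicit Types (a : nat -> int) (c : R).

Definition hyperplane n a c : set (euclid R n) :=
  [set t | \sum_(i < n) (a i)%:~R * nth (0 : R) t i = c].

Lemma measurable_hyperplane n a c : measurable (@hyperplane n a c).
Proof.
have mf : measurable_fun setT
    (fun t : euclid R n => \sum_(i < n) (a i)%:~R * tnth t i : R).
  apply: measurable_sum => i; apply: measurable_funM; first exact: measurable_cst.
  exact: measurable_tnth.
rewrite (_ : hyperplane a c = [set: euclid R n] `&`
  (fun t : euclid R n => \sum_(i < n) (a i)%:~R * tnth t i : R) @^-1` [set c]).
  by apply: mf => //; exact: measurable_set1.
rewrite setTI; apply/seteqP; split=> t; rewrite /hyperplane /preimage/= => <-;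
  by apply: eq_bigr => i _; rewrite (tnth_nth 0).
Qed.

(** By integration over the first coordinate: if a later coefficient is nonzero, every slice is a
    null hyperplane by induction; otherwise the set is a point times the remaining space. *)
Lemma lebesgue_hyperplane n a c : (exists2 i, (i < n)%N & a i != 0) ->
  lebesgue_tuple (@hyperplane n a c) = 0%E.
Proof.
elim: n a c => [|n ih] a c [i iN ai]; first by [].
have BE : @tuple_of_pair R n @^-1` hyperplane a c =
  [set p : measurableTypeR R * euclid R n |
    (a 0%N)%:~R * p.1 + \sum_(i < n) (a i.+1)%:~R * nth (0 : R) p.2 i = c].
  by apply/seteqP; split=> -[x t]; rewrite /preimage /hyperplane/= big_ord_recl.
rewrite /= /pushforward BE.
have [[j jn aj]|na] := pselect (exists2 j, (j < n)%N & a j.+1 != 0).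
  apply: integral0_eq => x _ /=.
  rewrite -[RHS](ih (fun i => a i.+1) (c - (a 0%N)%:~R * x)); last by exists j.
  congr lebesgue_tuple; apply/seteqP; split=> t.
    rewrite /xsection/= inE /hyperplane/= => <-; lra.
  rewrite /xsection/= inE /hyperplane/= => ->; lra.
have aj0 j : (j < n)%N -> a j.+1 = 0.
  by move=> jn; apply/eqP/negPn/negP => aj; apply: na; exists j.
have a0 : (a 0%N)%:~R != 0 :> R.
  by rewrite intr_eq0; case: i iN ai => // i iN; rewrite aj0.
set B := (X in product_measure1 _ _ X).
have -> : B = [set c / (a 0%N)%:~R] `*` [set: euclid R n].
  apply/seteqP; split=> -[x t]; rewrite /B/=.
    rewrite big1 ?addr0 => [<-|j _]; last by rewrite aj0// mul0r.
    by split=> //; rewrite mulrAC mulfV// mul1r.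
  move=> [-> _]; rewrite big1 ?addr0 => [|j _]; last by rewrite aj0// mul0r.
  by rewrite mulrCA mulfV// mulr1.
by rewrite product_measure1E//= lebesgue_measure_set1 mul0e.
Qed.

Definition rationally_dependent n : set (euclid R n) :=
  [set t | exists a, (exists2 i, (i < n)%N & a i != 0) /\ hyperplane a 0 t].

(** Integer vectors are countable, here enumerated by [unpickle] on [seq int], so countably many
    null hyperplanes cover the set. *)
Lemma rationally_dependent_negligible n :
  (@lebesgue_tuple R n).-negligible (@rationally_dependent n).
Proof.
pose F k : set (euclid R n) := [set t | exists s : seq int,
  [/\ unpickle k = Some s, (exists2 i, (i < n)%N & s`_i != 0)
    & hyperplane (fun i => s`_i) 0 t]].
apply: (@negligibleS _ _ _ _ (\bigcup_k F k)).
  move=> t [a [[i iN ai] at0]]; exists (pickle (mkseq a n)) => //.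
  exists (mkseq a n); split; first exact: pickleK.
    by exists i; rewrite // nth_mkseq.
  by apply: etrans at0; apply: eq_bigr => j _; rewrite nth_mkseq.
apply: negligible_bigcup => k.
case E : (unpickle k : option (seq int)) => [s|]; last first.
  rewrite (_ : F k = set0); first exact: negligible_set0.
  by apply/seteqP; split=> t // [s []]; rewrite E.
have [s0|ns0] := pselect (exists2 i, (i < n)%N & s`_i != 0); last first.
  rewrite (_ : F k = set0); first exact: negligible_set0.
  by apply/seteqP; split=> t // [s' []]; rewrite E => -[<-].
apply: (@negligibleS _ _ _ _ (hyperplane (fun i => s`_i) 0)).
  by move=> t [s' []]; rewrite E => -[<-].
apply/negligibleP; first exact: measurable_hyperplane.
exact: lebesgue_hyperplane.
Qed.

Lemma generic_independent r (v : euclid R (2 * r - 1)) :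
  ~ rationally_dependent v ->
  independent r (beta v) (fun i => gamma v i.+1).
Proof.
move=> gen n m E.
(* The entry of [v] at position [k >= r] is [beta] of index [(k - r).+1]. *)
pose a k : int := if (k < r)%N then n k else m (k - r).+1.
have [r0|r0] := posnP r.
  by split=> j; rewrite r0 // ltn0 andbF.
have S : hyperplane a 0 v.
  rewrite /hyperplane/= -[RHS]E.
  rewrite -(big_mkord xpredT (fun k => (a k)%:~R * nth (0 : R) v k)).
  rewrite (@big_cat_nat _ _ _ r)//=; last by lia.
  congr +%R.
    by rewrite big_mkord; apply: eq_bigr => i _; rewrite /a ltn_ord.
  rewrite -[X in index_iota X _](_ : 1 + r.-1 = r)%N; last by lia.
  rewrite big_addn (_ : 2 * r - 1 - r.-1 = r)%N; last by lia.
  rewrite !big_nat; apply: eq_bigr => j jr.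
  rewrite /a /beta (_ : (j + r.-1 < r)%N = false); last by lia.
  have -> : (j == 0)%N = false by lia.
  have -> : (j == r)%N = false by lia.
  have -> : (j + r.-1 - r).+1 = j by lia.
  by have -> : (j + r.-1 = r + j.-1)%N by lia.
have Z k : (k < 2 * r - 1)%N -> a k = 0.
  move=> kr; apply/eqP/negPn/negP => ak; apply: gen; exists a; split=> //.
  by exists k.
split=> [i ir|j jr].
  by have := Z i; rewrite /a ir; apply; lia.
have := Z (j + r.-1)%N; rewrite /a (_ : (j + r.-1 < r)%N = false); last by lia.
have -> : (j + r.-1 - r).+1 = j by lia.
by apply; lia.
Qed.

End hyperplanes.

(** * Images, attractor and components of an interval translation map *)

Section interval_translation_maps.
Context {R : realType} (r : nat) (v : euclid R (2 * r - 1)).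
Context (r2 : (2 <= r)%N) (vITM : ITM R r v).
Local Notation ga := (fun i => gamma v i.+1).
Local Notation T := (tr r (beta v) ga true).

Lemma ITM_partition : is_partition r (beta v).
Proof.
split; [by []| |by have [] := vITM].
by rewrite /beta eqxx (_ : r == 0%N = false)//; lia.
Qed.

Lemma itmE z : 0 <= z < 1 -> itm v z = T z.
Proof.
move=> z01; rewrite /itm trE; congr +%R; rewrite big_add1/= big_mkord.
have ir := idx_lt ITM_partition true z.
have /(_ erefl) zi := (idx_trueP ITM_partition ir z01).1.
rewrite (bigD1 (Ordinal ir))//= big1 ?addr0// => i /andP[iz ni].
move: ni; rewrite -(inj_eq val_inj)/= => /eqP[].
exact/esym/(idx_true_eq ITM_partition).
Qed.

Lemma tr_unit z : 0 <= z < 1 -> 0 <= T z < 1.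
Proof.
move=> z01; have ir := idx_lt ITM_partition true z.
have /(_ erefl) := (idx_trueP ITM_partition ir z01).1.
have [_ /(_ (idx r (beta v) true z).+1)] := vITM.
by rewrite trE ir/= => /(_ isT); lra.
Qed.

Lemma itm_imageS n : (itm_image v n `<=` `[0, 1[) /\
  itm_image v n.+1 = T @` itm_image v n.
Proof.
have sub : itm_image v n `<=` `[0, 1[.
  elim: n => [|n ih] _ [p p01 <-] //=.
  have /ih : itm_image v n (iter n (itm v) p) by exists p.
  by rewrite /= !in_itv/= => h; rewrite itmE// tr_unit.
split=> //; apply/seteqP; split=> [_ [p p01 <-]|_ [_ [p p01 <-] <-]].
  have pn : itm_image v n (iter n (itm v) p) by exists p.
  exists (iter n (itm v) p) => //=.
  by rewrite itmE//; have := sub _ pn; rewrite /= in_itv.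
have pn : itm_image v n (iter n (itm v) p) by exists p.
exists p => //=.
by rewrite itmE//; have := sub _ pn; rewrite /= in_itv.
Qed.

Lemma step_set_tr_image (X : set R) : step_set X -> step_set (T @` X).
Proof.
move=> sX; rewrite (_ : T @` X = (fun w => exists2 i, i \in iota 0 r &
    (X `&` (fun u => idx r (beta v) true u = i)) (w - ga i))).
  apply: step_set_ex => i _.
  exact: (step_set_shift (ga i) (step_setI sX (step_idx r (beta v) i))).
apply/seteqP; split=> [_ [p Xp <-]|w [i _ [Xw iw]]].
  exists (idx r (beta v) true p); last by rewrite trE addrK.
  by rewrite mem_iota (idx_lt ITM_partition).
by exists (w - ga i) => //; rewrite trE iw subrK.
Qed.

Lemma itm_image_step n : step_set (itm_image v n).
Proof.
elim: n => [|n ih]; last by rewrite (itm_imageS n).2; exact: step_set_tr_image.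
rewrite (_ : itm_image v 0 = (fun w => 0 <= w < 1)); first exact: step_set_itv.
apply/seteqP; split=> [_ [p + <-]|w w01]; first by rewrite /= in_itv.
by exists w => //; rewrite /= in_itv.
Qed.

Lemma itm_image_measurable n :
  measurable (itm_image v n : set (measurableTypeR R)).
Proof.
elim: n => [|n ih].
  rewrite (_ : itm_image v 0 = `[0, 1[%classic); first exact: measurable_itv.
  by apply/seteqP; split=> [_ [p + <-]//|w w01]; exists w.
have [sub ->] := itm_imageS n.
by apply: measurable_tr_image => //; exact: ITM_partition.
Qed.

(** Points of a set inside its own image can be pulled back [n] times within the set. *)
Lemma itm_image_max (N : set R) n : N `<=` `[0, 1[ -> N `<=` T @` N ->
  N `<=` itm_image v n.
Proof.
move=> N01 NT; elim: n => [|n ih] z Nz; first by exists z => //; exact: N01.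
rewrite (itm_imageS n).2; have [p Np <-] := NT z Nz.
by exists p => //; exact: ih.
Qed.

(** The stable image is mapped onto itself, so it survives in all images by [itm_image_max]. *)
Lemma attractorE n : itm_image v n.+1 = itm_image v n ->
  attractor v = itm_image v n.
Proof.
move=> E; apply/seteqP; split=> [z|]; first by move=> /(_ n I).
have [sub TE] := itm_imageS n.
by move=> z Xz m _; apply: itm_image_max Xz => //; rewrite -TE E.
Qed.

(** If the attractor continued past an end, it would contain a longer interval around [z], against
    maximality of the connected component. *)
Lemma interval_component_ends x y : interval_component v x y ->
  [/\ x < y, forall w, x <= w < y -> attractor v w,
      endpoint (attractor v) true x & endpoint (attractor v) false y].
Proof.
move=> [z Xz CE].
have JX w : x <= w < y -> attractor v w.
  move=> wxy; apply: (@connected_component_sub _ _ z).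
  by rewrite CE /= in_itv.
have zJ : x <= z < y.
  have := connected_component_refl Xz; rewrite CE /=; by rewrite in_itv.
have xy : x < y by lra.
have mx (B : interval R) : z \in B -> [set` B] `<=` attractor v ->
    [set` B] `<=` `[x, y[.
  move=> zB BX; rewrite -CE; apply: connected_component_max => //.
  exact/connected_intervalP/interval_is_interval.
split=> //; split.
- exists (y - x) => [|w]; first by rewrite subr_gt0.
  by rewrite addrC subrK; exact: JX.
- move=> [e e0 eX].
  have : `[x, y[%classic (x - e / 2); last by rewrite /= in_itv/=; lra.
  apply: (mx `[x - e / 2, y[); rewrite /= ?in_itv/=; [lra| |lra] => w /=.
  rewrite in_itv/= => wxy; have [xw|wx] := leP x w; first by apply: JX; lra.
  by apply: eX => /=; lra.
- exists (y - x) => [|w /= wxy]; first by rewrite subr_gt0.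
  by apply: JX; lra.
- move=> [e e0 eX].
  have : `[x, y[%classic y; last by rewrite /= in_itv/=; lra.
  apply: (mx `[x, y]); rewrite /= ?in_itv/=; [lra| |lra] => w /=.
  rewrite in_itv/= => wxy; have [wy|yw] := ltP w y; first by apply: JX; lra.
  by apply: eX => /=; lra.
Qed.

(** Finite type makes the attractor a stable image: a step set, maximal among sets inside their own
    image, on which the surjective map is injective by measure. *)
Lemma finite_type_irrational_rotation : independent r (beta v) ga ->
  finite_type v -> irrational_rotation_type R r v.
Proof.
move=> ind fv; split=> // x y; have [n En] := fv.
have XE := attractorE En.
have [sub TE] := itm_imageS n; rewrite En in TE.
have part := ITM_partition.
have sys : bijective_system r (beta v) ga (attractor v).
  rewrite XE; split=> //; first exact: itm_image_step.
  apply: surjective_injective => //; first exact: itm_image_step.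
  exact: itm_image_measurable.
have maxX N : N `<=` `[0, 1[ -> N `<=` T @` N -> N `<=` attractor v.
  by rewrite XE; exact: itm_image_max.
move=> /interval_component_ends[xy JX ex ey].
have [d rot] := ret_rotation part sys ind maxX xy JX ex ey.
exists (d / (y - x)); first exact: (ret_irrational part sys ind xy JX ex rot).
move=> z Jz.
(* The orbit stays in the attractor, inside [[0, 1[], where [itm v] and the right-sided map
   coincide. *)
have itE k : iter k (itm v) z = orb r (beta v) ga true k z.
  elim: k => // k ih; rewrite iterS ih itmE//.
  have := germ_at (germ_orb sys k (JX_germ sys JX Jz)).
  by have [_ X01 _ _] := sys => /X01; rewrite /= in_itv.
have timeE k : is_return_time (itm v) `[x, y[ z k <->
    ret r (beta v) ga x y true z k.
  split=> -[k0 Jk kJ]; split=> //.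
  - by move: Jk; rewrite itE /= in_itv.
  - by move=> m mk; move: (kJ m mk); rewrite itE /= in_itv.
  - by rewrite itE /= in_itv.
  - by move=> m mk; move: (kJ m mk); rewrite itE /= in_itv.
have [k0 rk0] := recurrence sys xy JX ex (Jz : inJ x y true z).
(* Recurrence supplies a return time, so [xget] does not fall back on its default 0. *)
have /timeE rk : is_return_time (itm v) `[x, y[ z
    (first_return_time (itm v) `[x, y[ z).
  by apply: xgetPex; exists k0; apply/timeE.
have [_ Jk _] := rk; have [m Em] := rot z _ Jz rk.
rewrite /first_return_map itE; split=> //; exists m.
by rewrite divfK// subr_eq0 gt_eqF.
Qed.

End interval_translation_maps.

Theorem theoremA8 (R : realType) (BK : Boshernitzan_Kornfeld R)
  (r : nat) (hr : (2 <= r)%N) :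
  (@lebesgue_tuple R (2 * r - 1)%N).-negligible
    (ITM R r `\` irrational_rotation_type R r).
Proof.
(* The exceptional maps are of infinite type or have rationally dependent parameters. *)
apply: negligibleS (negligibleU (BK r hr) (@rationally_dependent_negligible R _)).
move=> v [vITM nv]; have [fv|] := pselect (finite_type v); last by left.
right; apply: contrapT => /generic_independent ind; apply: nv.
exact: finite_type_irrational_rotation.
Qed.
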